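(* Let $\pi$ be a set partition of $[n]$ and let $\lambda=\lambda(\pi)$. Then: (1) $\mathbf{P}_\pi(1)=\lambda!\,\mathbf{m}_\pi$. (2) $\rho(\mathbf{P}_\pi(t))=\lambda!\,\lambda^!\,P_\lambda(t)$. Consequently, $\rho(\mathbf{s}_\pi)=\lambda!\,\lambda^!\,s_\lambda$.
   Context: Set partitions. A set partition $\pi=\pi_1/\cdots/\pi_l\vdash[n]$ is a set of disjoint nonempty blocks with union $[n]$; $\lambda(\pi)$ is the partition of $n$ listing the block sizes in weakly decreasing order. A permutation $\delta\in\mathfrak{S}_n$ acts by $\delta\pi=\delta(\pi_1)/\cdots/\delta(\pi_l)$. For a partition $\mu=(\mu_1,\ldots,\mu_l)\vdash n$, $[\mu]$ is the set partition of $[n]$ whose blocks are the consecutive intervals $\{1,\ldots,\mu_1\},\{\mu_1+1,\ldots,\mu_1+\mu_2\},\ldots$. The permutation $\delta_\pi\in\mathfrak{S}_n$ is given in one-line notation by listing the blocks of $\pi$ in weakly decreasing size, blocks of equal size in increasing order of smallest element, the elements of each block in increasing order, and erasing the bars; thus $\pi=\delta_\pi[\lambda(\pi)]$. For a partition $\mu=(\mu_1,\ldots,\mu_l)=\langle 1^{m_1}2^{m_2}\cdots\rangle$ put $\mu!=\mu_1!\cdots\mu_l!$ and $\mu^!=m_1!m_2!\cdots$. The order $\le$ on partitions of $n$ is dominance order. Noncommuting variables $\mathbf{x}=(\mathbf{x}_1,\mathbf{x}_2,\ldots)$. A permutation $\delta\in\mathfrak{S}_n$ acts by $\delta\circ(\mathbf{x}_{i_1}\cdots\mathbf{x}_{i_n})=\mathbf{x}_{i_{\delta^{-1}(1)}}\cdots\mathbf{x}_{i_{\delta^{-1}(n)}}$,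 extended linearly. For $\pi\vdash[n]$, $\mathbf{m}_\pi=\sum\mathbf{x}_{i_1}\cdots\mathbf{x}_{i_n}$ over tuples of positive integers with $i_a=i_b$ iff $a,b$ are in the same block of $\pi$. The projection map $\rho$ is the linear map from power series in the noncommuting variables $\mathbf{x}_i$ to power series in the commuting variables $x_i$ that lets the variables commute ($\mathbf{x}_i\mapsto x_i$; it is linear over polynomials in $t$). HL functions. $P_\lambda(t)$ is the classical Hall-Littlewood symmetric function in commuting variables, $s_\lambda=P_\lambda(0)$ is the Schur function, and $c_{\lambda\mu}(t)\in\mathbb{Z}[t]$ are defined by $P_\lambda(t)=\sum_{\mu\le\lambda}c_{\lambda\mu}(t)m_\mu$. For $\pi\vdash[n]$ with $\lambda(\pi)=\lambda$, $$\mathbf{P}_\pi(t)=\sum_{\mu\le\lambda}\frac{c_{\lambda\mu}(t)}{\mu^!}\sum_{g\in G_\pi}g\circ\mathbf{m}_{\delta_\pi[\mu]},\qquad G_\pi=\{\delta\in\mathfrak{S}_n:\delta\pi=\pi\},$$ and $\mathbf{s}_\pi=\mathbf{P}_\pi(0)$. *)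

(* Defs.v *)
From HB Require Import structures.
From mathcomp Require Import all_boot all_order all_fingroup all_algebra.
From mathcomp Require Import finmap multiset mpoly.
From mathcomp Require Import boolp.
From mathcomp Require classical_sets.

Set Implicit Arguments.
Unset Strict Implicit.
Unset Printing Implicit Defensive.

Import GRing.Theory.

Local Open Scope mset_scope.
Local Open Scope ring_scope.

Definition is_intpart (n : nat) (s : seq nat) : bool :=
  [&& sorted geq s, 0%N \notin s & sumn s == n].

Record intpart (n : nat) :=
  IntPart { parts :> seq nat; intpartP : is_intpart n parts }.

HB.instance Definition _ n := [isSub for @parts n].
HB.instance Definition _ n := [Countable of intpart n by <:].

Section IntpartFinite.
Variable n : nat.

Definition intpart_code (mu : intpart n) : n.-bseq 'I_n.+1 :=
  insub_bseq n (map inord mu).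

Definition intpart_decode (b : n.-bseq 'I_n.+1) : option (intpart n) :=
  insub (map val b).

Lemma intpart_codeK : pcancel intpart_code intpart_decode.
Proof.
case=> s Hs; have /and3P[_ s0 /eqP sn] := Hs.
have le_s x : x \in s -> (x <= n)%N.
  by move=> xs; rewrite -sn sumnE (big_rem x) //= leq_addr.
have sz_s : (size s <= n)%N.
  rewrite -sn; elim: {le_s sn Hs} s s0 => //= x s IHs.
  rewrite inE negb_or eq_sym -lt0n => /andP[x0 /IHs Hs].
  by rewrite -add1n leq_add.
have Es : map val (map (@inord n) s) = s.
  by rewrite -map_comp map_id_in // => x /le_s xn /=; rewrite inordK.
rewrite /intpart_decode /intpart_code /insub_bseq insubdK /= ?Es.
  by rewrite insubT.
by rewrite unfold_in size_map.
Qed.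
End IntpartFinite.

HB.instance Definition _ n : isFinite (intpart n) := PCanIsFinite (@intpart_codeK n).

(* Dominance order mu <= la on the partitions of n; taking k <= n is enough,
   as a partition of n has at most n parts. *)
Definition dominated n (mu la : intpart n) : bool :=
  [forall k : 'I_n.+1, (sumn (take k mu) <= sumn (take k la))%N].

Definition part_fact (mu : seq nat) : nat := (\prod_(p <- mu) p`!)%N.

Definition mult_fact n (mu : intpart n) : nat :=
  (\prod_(1 <= i < n.+1) (count_mem i mu)`!)%N.

(* The set [n] is 'I_n, i.e. its elements are shifted to 0, ..., n-1. *)
Record setpart (n : nat) := SetPart {
  blocks :> {set {set 'I_n}};
  setpartP : partition blocks [set: 'I_n] }.

Definition perm_act n (d : 'S_n) (P : {set {set 'I_n}}) : {set {set 'I_n}} :=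
  [set d @: (B : {set 'I_n}) | B in P].

Definition block_sizes n (P : {set {set 'I_n}}) : seq nat :=
  sort geq [seq #|(B : {set 'I_n})| | B <- enum P].

Lemma block_sizesP n (pi : setpart n) : is_intpart n (block_sizes pi).
Proof.
case: pi => P /= HP; apply/and3P; split.
- by apply: sort_sorted => x y; rewrite orbC; apply: leq_total.
- rewrite mem_sort; apply/negP => /mapP[B]; rewrite mem_enum => BP /esym/eqP.
  by rewrite cards_eq0 => /eqP B0; case/and3P: HP => _ _; rewrite -B0 BP.
- have /perm_sumn -> := permEl (perm_sort geq [seq #|(B : {set 'I_n})| | B <- enum P]).
  by rewrite sumnE big_map big_enum /= -(card_partition HP) cardsT card_ord.
Qed.

Definition block_type n (pi : setpart n) : intpart n := IntPart (block_sizesP pi).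

Definition interval_blocks n (mu : intpart n) : {set {set 'I_n}} :=
  [set [set a : 'I_n | (sumn (take i mu) <= a < sumn (take i.+1 mu))%N]
     | i : 'I_(size mu)].

(* For a nonempty B the value is its least element, as all elements are < n. *)
Definition min_elt n (B : {set 'I_n}) : nat := \big[minn/n]_(i in B) i.

Definition block_le n (B C : {set 'I_n}) : bool :=
  (#|C| < #|B|)%N || (#|B| == #|C|) && (min_elt B <= min_elt C)%N.

(* The enumeration of a set of 'I_n is increasing. *)
Definition one_line n (P : {set {set 'I_n}}) : seq 'I_n :=
  flatten [seq enum (B : {set 'I_n}) | B <- sort (@block_le n) (enum P)].

Lemma one_line_perm n (pi : setpart n) : perm_eq (one_line pi) (enum 'I_n).
Proof.
case: pi => P /= HP; have /and3P[/eqP covP trivP _] := HP.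
apply/allP => x _ /=; rewrite (count_uniq_mem x (enum_uniq _)) mem_enum /=.
have HS : perm_eq (sort (@block_le n) (enum P)) (enum P).
  exact: permEl (perm_sort _ _).
rewrite /one_line (seq.permP (perm_flatten (perm_map _ HS))) count_flatten -map_comp.
rewrite sumnE big_map big_enum /=.
have xP : x \in cover P by rewrite covP inE.
rewrite (bigD1 (pblock P x)) ?pblock_mem //= big1 => [|B /andP[BP BNx]].
  by rewrite addn0 (count_uniq_mem x (enum_uniq _)) mem_enum mem_pblock xP.
rewrite (count_uniq_mem x (enum_uniq _)) mem_enum; apply/eqP; rewrite eqb0.
by apply: contraNN BNx => xB; rewrite (def_pblock trivP BP xB).
Qed.

Lemma one_line_size n (pi : setpart n) : size (one_line pi) = n.
Proof. by rewrite (perm_size (one_line_perm pi)) size_enum_ord. Qed.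

Definition one_line_fun n (pi : setpart n) (i : 'I_n) : 'I_n :=
  tnth (in_tuple (one_line pi)) (cast_ord (esym (one_line_size pi)) i).

Lemma one_line_inj n (pi : setpart n) : injective (one_line_fun pi).
Proof.
have U : uniq (one_line pi) by rewrite (perm_uniq (one_line_perm pi)) enum_uniq.
move=> i j; rewrite /one_line_fun !(tnth_nth i) /= => /eqP.
by rewrite nth_uniq ?one_line_size // => /eqP/val_inj.
Qed.

Definition delta n (pi : setpart n) : 'S_n := perm (@one_line_inj n pi).

Definition stab n (pi : setpart n) : {set 'S_n} :=
  [set d : 'S_n | perm_act d pi == pi :> {set {set 'I_n}}].

(* The variables are x_0, x_1, ... .  A noncommutative monomial is the word of
   its indices, a commutative one is the multiset of its indices, and a power
   series is the function giving its coefficients. *)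
Definition ncseries (R : Type) : Type := seq nat -> R.
Definition series (R : Type) : Type := {mset nat} -> R.

(* The coefficient at m of the commutative image is the sum of the coefficients
   at the (distinct) words whose letters form the multiset m. *)
Definition rho (R : nmodType) (F : ncseries R) : series R :=
  fun m => \sum_(w <- permutations (enum_mset m)) F w.

(* delta o (x_(i_1) ... x_(i_n)); 'S_n acts on words of length n only, and words
   of other lengths are left unchanged. *)
Definition word_act n (d : 'S_n) (w : seq nat) : seq nat :=
  if size w == n then [seq nth 0%N w (d^-1%g i) | i <- enum 'I_n] else w.

(* As word_act d is a bijection with inverse word_act d^-1, the coefficient at w
   of the linear extension is that of F at the preimage of w. *)
Definition nc_act (R : Type) n (d : 'S_n) (F : ncseries R) : ncseries R :=
  fun w => F (word_act d^-1%g w).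

Definition nc_monomial (R : pzSemiRingType) n (P : {set {set 'I_n}}) : ncseries R :=
  fun w => ((size w == n) &&
    [forall a : 'I_n, forall b : 'I_n,
       (nth 0 w a == nth 0 w b)%N == (pblock P a == pblock P b)])%:R.

Definition monomial_sym (R : pzSemiRingType) (mu : seq nat) : series R :=
  fun m => (perm_eq [seq m i | i <- finsupp m] mu)%:R.

(* The Hall-Littlewood polynomial in N >= size la variables, as the element
     sum_(w in S_N / S_N^la)
       w (x^la * prod_(la_i > la_j) (x_i - t x_j) / (x_i - x_j))
   of the field of fractions of Z[t][x_0, ..., x_(N-1)].  The cosets w S_N^la
   correspond to the distinct rearrangements a = w(la) of la padded with zeros,
   and the term for w is x^a * prod_(a_i > a_j) (x_i - t x_j) / (x_i - x_j). *)
Definition hl_frac (N : nat) (la : seq nat) : {fraction {mpoly {poly int}[N]}} :=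
  let x (i : 'I_N) := tofrac ('X_i : {mpoly {poly int}[N]}) in
  let t := tofrac (('X : {poly int})%:MP_[N]) in
  \sum_(a <- permutations (la ++ nseq (N - size la) 0%N))
    (\prod_(i < N) x i ^+ nth 0%N a i) *
    \prod_(i < N) \prod_(j < N | (nth 0 a j < nth 0 a i)%N)
      ((x i - t * x j) / (x i - x j)).

(* F is the stable limit of the Hall-Littlewood polynomials: for N >= size la,
   setting x_N = x_(N+1) = ... = 0 in F gives the one in N variables. *)
Definition is_hall_littlewood (la : seq nat) (F : series {poly int}) : Prop :=
  forall N, (size la <= N)%N ->
    exists p : {mpoly {poly int}[N]},
      tofrac p = hl_frac N la /\
      forall m : {mset nat}, (forall i, (N <= i)%N -> m i = 0%N) ->
        F m = p@_[multinom m i | i < N].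

Definition hall_littlewood (la : seq nat) : series {poly int} :=
  classical_sets.xget (fun=> 0) (is_hall_littlewood la).

Definition schur (la : seq nat) : series int :=
  fun m => (hall_littlewood la m).[0].

(* mu |-> c_(la,mu)(t); only the values at mu <= la are meaningful. *)
Definition hl_coef n (la : intpart n) : intpart n -> {poly int} :=
  classical_sets.xget (fun=> 0)
    (fun c : intpart n -> {poly int} => forall m : {mset nat},
       hall_littlewood la m =
       \sum_(mu : intpart n | dominated mu la) c mu * monomial_sym _ mu m).

(* The coefficients are in Q[t] because of the division by mu^!. *)
Definition nc_hall_littlewood n (pi : setpart n) : ncseries {poly rat} :=
  fun w => \sum_(mu : intpart n | dominated mu (block_type pi))
    (mult_fact mu)%:R^-1 *: map_poly intr (hl_coef (block_type pi) mu) *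
    \sum_(g in stab pi)
      nc_act g (nc_monomial _ (perm_act (delta pi) (interval_blocks mu))) w.

Definition nc_hall_littlewood_at n (pi : setpart n) (t : rat) : ncseries rat :=
  fun w => (nc_hall_littlewood pi w).[t].

Definition nc_schur n (pi : setpart n) : ncseries rat :=
  nc_hall_littlewood_at pi 0.

(* Main.v *)
Require Import Defs.
From HB Require Import structures.
From mathcomp Require Import all_boot all_order all_fingroup all_algebra.
From mathcomp Require Import finmap multiset mpoly.
From mathcomp Require Import boolp ring.
From mathcomp Require classical_sets.

(** Clearing denominators, the Hall-Littlewood polynomial in N variables is a
    quotient of the symmetric numerator [hl_num] by the product of all
    [x_i - x_j], i <> j.  Every term of the numerator is divisible by
    [x_i - x_j] and the quotient is antisymmetric in [x_i] and [x_j], so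
    [(x_i - x_j)^2] divides the numerator and the quotient is a polynomial.  Each
    [(x_i - t x_j) / (x_i - x_j)] has degree zero for every weight of the
    variables, so all exponents of the quotient are dominated by lambda; the
    fractions are 1 at t = 1, hence P_lambda(1) = m_lambda.
      On the noncommutative side, every set partition is the kernel of a function
    on [n].  The words with a given kernel pi and content m are a torsor under
    the permutations of the parts of mu = lambda(pi) preserving their sizes, so
    rho(m_pi) = mu^! m_mu, and the same count gives |G_pi| = lambda! lambda^!.
    Both parts follow, as g o m_pi = m_(g pi) and delta_pi [lambda] = pi. *)

Set Implicit Arguments.
Unset Strict Implicit.
Unset Printing Implicit Defensive.
Import GRing.Theory.
Local Open Scope mset_scope.
Local Open Scope ring_scope.

(** * Rearrangements of words *)

Section WordAction.
Variable n : nat.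
Implicit Types (d : 'S_n) (w : seq nat).

Lemma nth_enum_map (T : Type) (x0 : T) (F : 'I_n -> T) (i : 'I_n) :
  nth x0 [seq F j | j <- enum 'I_n] i = F i.
Proof. by rewrite (nth_map i) ?size_enum_ord // nth_ord_enum. Qed.

Lemma map_nth_enum w : size w = n -> [seq nth 0%N w i | i : 'I_n <- enum 'I_n] = w.
Proof.
move=> sw; apply: (@eq_from_nth _ 0%N); rewrite size_map size_enum_ord // => i ltin.
by rewrite (nth_enum_map _ _ (Ordinal ltin)).
Qed.

Lemma size_word_act d w : size (word_act d w) = size w.
Proof.
by rewrite /word_act; case: eqP => // sw; rewrite size_map size_enum_ord.
Qed.

Lemma nth_word_act d w (i : 'I_n) : size w = n ->
  nth 0%N (word_act d w) i = nth 0%N w (d^-1%g i).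
Proof. by rewrite /word_act => ->; rewrite eqxx nth_enum_map. Qed.

Lemma word_actK d : cancel (word_act d) (word_act d^-1%g).
Proof.
move=> w; have [sw|sw] := eqVneq (size w) n; last first.
  by rewrite /word_act (negPf sw) (negPf sw).
apply: (@eq_from_nth _ 0%N); rewrite !size_word_act // sw => i ltin.
by rewrite -[i]/(val (Ordinal ltin)) !nth_word_act ?size_word_act // permKV.
Qed.

Lemma perm_word_act d w : perm_eq (word_act d w) w.
Proof.
have [sw|sw] := eqVneq (size w) n; last by rewrite /word_act (negPf sw).
rewrite /word_act sw eqxx -[X in perm_eq _ X](map_nth_enum sw).
rewrite (map_comp (fun i : 'I_n => nth 0%N w i) (fun i => d^-1%g i)); apply: perm_map.
apply: uniq_perm; rewrite ?(map_inj_uniq perm_inj) ?enum_uniq // => i.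
by rewrite mem_enum -[i](permK d) mem_map ?mem_enum //; exact: perm_inj.
Qed.

Lemma permutations_word_act d w :
  perm_eq [seq word_act d a | a <- permutations w] (permutations w).
Proof.
apply: uniq_perm; rewrite ?(map_inj_uniq (can_inj (word_actK d))) ?permutations_uniq //.
move=> a; rewrite mem_permutations; apply/mapP/idP => [[b]|aw].
  by rewrite mem_permutations => bw ->; apply: perm_trans (perm_word_act _ _) bw.
exists (word_act d^-1%g a); last by rewrite -{1}[d]invgK word_actK.
by rewrite mem_permutations (perm_trans (perm_word_act _ _)).
Qed.

End WordAction.

(** Divisibility by pairwise coprime squares without unique factorization: [f i] has its kernel
    inside the ideal of [d i], so [d i] behaves as a prime, and [f i (d k) != 0] plays the role of
    coprimality. *)
Lemma prod_sqr_dvd (A : idomainType) (I : eqType) (d : I -> A)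
    (f : I -> {rmorphism A -> A}) (e : seq I) (Q : A) : uniq e ->
  (forall i q, i \in e -> f i q = 0 -> exists C, q = d i * C) ->
  (forall i, i \in e -> f i (d i) = 0) ->
  (forall i k, i \in e -> k \in e -> i != k -> f i (d k) != 0) ->
  (forall i, i \in e -> exists C, Q = d i ^+ 2 * C) ->
  exists C, Q = (\prod_(i <- e) d i ^+ 2) * C.
Proof.
elim: e => [|i e IHe] /=; first by exists Q; rewrite big_nil mul1r.
case/andP=> ie ue kerd fd0 fdN0 dvdQ.
have sub k : k \in e -> k \in i :: e by rewrite inE => ->; rewrite orbT.
have [C defQ] : exists C, Q = (\prod_(i <- e) d i ^+ 2) * C.
  apply: IHe => // [k q /sub|k /sub|k l /sub ke /sub|k /sub];
    [exact: kerd|exact: fd0| |exact: dvdQ].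
  exact: fdN0.
have ii : i \in i :: e by rewrite inE eqxx.
set B := \prod_(k <- e) _ in defQ *.
have fB : f i B != 0.
  rewrite rmorph_prod big_seq_cond prodf_seq_neq0; apply/allP => k ke /=.
  rewrite ke rmorphXn expf_neq0 // fdN0 //; first exact: sub.
  by apply: contra ie => /eqP ->.
(* Euclid's lemma for [d i]: the product [B] of the other squares survives [f i], so [f i] must kill
   [X]. *)
have step X Y : B * X = d i * Y -> exists Z, X = d i * Z.
  move=> eqXY; apply: kerd => //; apply/eqP; have/eqP: f i (B * X) = 0.
    by rewrite eqXY rmorphM fd0 ?mul0r.
  by rewrite rmorphM mulf_eq0 (negPf fB).
have [D defD] := dvdQ i ii.
have [C1 defC] : exists Z, C = d i * Z.
  by apply: (step _ (d i * D)); rewrite mulrA -expr2 -defD defQ.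
have [d0|dN0] := eqVneq (d i) 0.
  by exists 0; rewrite defD d0 expr2 !mul0r mulr0.
have [C2 defC1] : exists Z, C1 = d i * Z.
  apply: (step _ D); apply: (mulfI dN0); rewrite [RHS]mulrA -expr2 -defD defQ defC.
  by rewrite mulrCA.
by exists C2; rewrite big_cons -/B defQ defC defC1; ring.
Qed.

(** * Hall-Littlewood polynomials *)

Section HLNumerator.
Variables (R : idomainType) (t : R).

(** What the ordered pair [(i, j)] contributes once multiplied by [x_i - x_j]. For [a = [::]] all
    exponents default to 0, so [hl_prod N [::]] is the common denominator. *)
Definition hl_pair N (a : seq nat) (i j : 'I_N) : {mpoly R[N]} :=
  if i == j then 1
  else if (nth 0 a j < nth 0 a i)%N then 'X_i - t%:MP * 'X_j else 'X_i - 'X_j.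

Definition hl_prod N (a : seq nat) : {mpoly R[N]} :=
  \prod_(i < N) \prod_(j < N) hl_pair a i j.

Definition hl_num N (s : seq nat) : {mpoly R[N]} :=
  \sum_(a <- permutations s) (\prod_(i < N) 'X_i ^+ nth 0%N a i) * hl_prod N a.

Lemma mpolyX_sub_neq0 N (i j : 'I_N) : i != j -> 'X_i - 'X_j != 0 :> {mpoly R[N]}.
Proof.
move=> neq_ij; apply/eqP => /(congr1 (mcoeff U_(i)))/eqP.
by rewrite mcoeffB !mcoeffXU mcoeff0 eqxx [j == i]eq_sym (negPf neq_ij) subr0 oner_eq0.
Qed.

Lemma hl_pair0 N (i j : 'I_N) :
  hl_pair [::] i j = if i == j then 1 else 'X_i - 'X_j.
Proof. by rewrite /hl_pair !nth_nil ltnn. Qed.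

Lemma hl_pair0_neq0 N (i j : 'I_N) : hl_pair [::] i j != 0.
Proof.
by rewrite hl_pair0; case: (eqVneq i j) => [_|neq]; [exact: oner_neq0|exact: mpolyX_sub_neq0].
Qed.

Lemma hl_prod0_neq0 N : hl_prod N [::] != 0.
Proof.
by apply/prodf_neq0 => i _; apply/prodf_neq0 => j _; apply: hl_pair0_neq0.
Qed.

Lemma msym_hl_pair N (s : 'S_N) (a : seq nat) (i j : 'I_N) : size a = N ->
  msym s (hl_pair a i j) = hl_pair (word_act s a) (s i) (s j).
Proof.
move=> sa; rewrite /hl_pair !nth_word_act // !permK (inj_eq perm_inj).
case: eqP => _; first by rewrite msym1.
have mX k : msym s 'X_k = 'X_(s k) :> {mpoly R[N]} by rewrite /msym mmapX mmap1U.
have mC : msym s t%:MP = t%:MP_[N] by rewrite /msym mmapC.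
by case: ifP => _; rewrite msymB ?msymM ?mC !mX.
Qed.

Lemma msym_hl_prod N (s : 'S_N) (a : seq nat) : size a = N ->
  msym s (hl_prod N a) = hl_prod N (word_act s a).
Proof.
move=> sa; rewrite rmorph_prod [RHS](reindex_inj (@perm_inj _ s)) /=.
apply: eq_bigr => i _; rewrite rmorph_prod [RHS](reindex_inj (@perm_inj _ s)) /=.
by apply: eq_bigr => j _; rewrite msym_hl_pair.
Qed.

Lemma msym_hl_prod0 N (s : 'S_N) : msym s (hl_prod N [::]) = hl_prod N [::].
Proof.
rewrite rmorph_prod [RHS](reindex_inj (@perm_inj _ s)) /=.
apply: eq_bigr => i _; rewrite rmorph_prod [RHS](reindex_inj (@perm_inj _ s)) /=.
apply: eq_bigr => j _; rewrite !hl_pair0 (inj_eq perm_inj); case: ifP; rewrite ?msym1 //.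
by rewrite msymB /msym !mmapX !mmap1U.
Qed.

(** Permuting the variables carries the term of [a] to the term of the rearranged word, and the sum
    runs over all rearrangements of [s]. *)
Lemma msym_hl_num N (p : 'S_N) (s : seq nat) : size s = N ->
  msym p (hl_num N s) = hl_num N s.
Proof.
move=> ss; rewrite /hl_num -[RHS](perm_big _ (permutations_word_act p s)).
rewrite big_map rmorph_sum big_seq [RHS]big_seq /=.
apply: eq_bigr => a; rewrite mem_permutations => /perm_size; rewrite ss => sa.
rewrite msymM msym_hl_prod //; congr (_ * _).
rewrite rmorph_prod [RHS](reindex_inj (@perm_inj _ p)) /=.
by apply: eq_bigr => j _; rewrite nth_word_act // permK rmorphXn /= /msym mmapX mmap1U.
Qed.

(** The substitution [x_i := x_j], used to test divisibility by [x_i - x_j]. *)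
Definition mpoly_ident N (i j : 'I_N) : {mpoly R[N]} -> {mpoly R[N]} :=
  mmap (@mpolyC N R) (fun k => if k == i then 'X_j else 'X_k).
HB.instance Definition _ N (i j : 'I_N) := GRing.RMorphism.on (mpoly_ident i j).

Lemma mpoly_identX N (i j k : 'I_N) :
  mpoly_ident i j 'X_k = 'X_(if k == i then j else k).
Proof. by rewrite /mpoly_ident mmapX mmap1U; case: ifP. Qed.

(** The property holds for constants and variables and is stable under sums and products, hence
    holds for all polynomials. *)
Lemma mpoly_ident_dvd N (i j : 'I_N) (q : {mpoly R[N]}) :
  exists C, q - mpoly_ident i j q = ('X_i - 'X_j) * C.
Proof.
pose P (q : {mpoly R[N]}) := exists C, q - mpoly_ident i j q = ('X_i - 'X_j) * C.
have PM q1 q2 : P q1 -> P q2 -> P (q1 * q2).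
  move=> [C1 e1] [C2 e2]; exists (C1 * q2 + mpoly_ident i j q1 * C2).
  rewrite rmorphM; set s1 := mpoly_ident i j q1 in e1 *; set s2 := mpoly_ident i j q2 in e2 *.
  have -> : q1 * q2 - s1 * s2 = (q1 - s1) * q2 + s1 * (q2 - s2) by ring.
  by rewrite e1 e2; ring.
have P1 : P 1 by exists 0; rewrite rmorph1 subrr mulr0.
elim/mpolyind: q => [|c m p _ _ [C e]].
  by exists 0; rewrite rmorph0 subrr mulr0.
suff [C' e'] : P (c *: 'X_[m]).
  by exists (C' + C); rewrite rmorphD opprD addrACA e e' mulrDr.
rewrite -mul_mpolyC; apply: (PM).
  by exists 0; rewrite /mpoly_ident mmapC subrr mulr0.
rewrite mpolyXE_id; apply: (big_ind P) => // k _.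
elim: (m k) => [|l IHl]; rewrite ?expr0 // exprS; apply: (PM) => //.
rewrite /P mpoly_identX; case: eqP => [->|_]; first by exists 1; rewrite mulr1.
by exists 0; rewrite subrr mulr0.
Qed.

Lemma mpoly_ident_eq0 N (i j : 'I_N) (q : {mpoly R[N]}) :
  mpoly_ident i j q = 0 -> exists C, q = ('X_i - 'X_j) * C.
Proof. by move=> q0; have [C e] := mpoly_ident_dvd i j q; exists C; rewrite -e q0 subr0. Qed.

Lemma mpoly_ident_tperm N (i j : 'I_N) (q : {mpoly R[N]}) :
  mpoly_ident i j (msym (tperm i j) q) = mpoly_ident i j q.
Proof.
elim/mpolyind: q => [|c m p _ _ IHp]; first by rewrite msym0.
rewrite msymD !rmorphD /= IHp; congr (_ + _).
rewrite -mul_mpolyC msymM !rmorphM /=; congr (_ * _).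
  by rewrite /msym mmapC.
rewrite mpolyXE_id !rmorph_prod; apply: eq_bigr => k _; rewrite !rmorphXn /=; congr (_ ^+ _).
rewrite /msym mmapX mmap1U !mpoly_identX.
by case: tpermP => [->|->|/eqP/negPf-> _] //; rewrite !eqxx if_same.
Qed.

(* The numerator is divisible by [x_i - x_j], and the quotient is antisymmetric
   in these two variables, hence divisible by [x_i - x_j] once more. *)
Lemma hl_num_sqr_dvd N (s : seq nat) (i j : 'I_N) : (2 : R) != 0 -> size s = N ->
  i != j -> exists C, hl_num N s = ('X_i - 'X_j) ^+ 2 * C.
Proof.
move=> R2 ss neq_ij.
have [M defM] : exists M, hl_num N s = ('X_i - 'X_j) * M.
  rewrite /hl_num; apply: (big_ind (fun q => exists M, q = ('X_i - 'X_j) * M)).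
  - by exists 0; rewrite mulr0.
  - by move=> _ _ [M1 ->] [M2 ->]; exists (M1 + M2); rewrite mulrDr.
  move=> a _; have [C ->] : exists C, hl_prod N a = ('X_i - 'X_j) * C.
    (* At most one of the factors for [(i, j)] and [(j, i)] carries [t]; the other is [x_i - x_j] up
       to sign. *)
    have [C defC] : exists C, hl_pair a i j * hl_pair a j i = ('X_i - 'X_j) * C.
      rewrite /hl_pair [j == i]eq_sym (negPf neq_ij).
      case: ltngtP => _; [exists (- ('X_i - t%:MP * 'X_j))|exists ('X_j - t%:MP * 'X_i)|exists
        ('X_j - 'X_i)]; ring.
    rewrite /hl_prod (bigD1 i) //= (bigD1 j) //= [X in _ * X](bigD1 j) 1?eq_sym //=.
    rewrite [X in _ * (X * _)](bigD1 i) //=.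
    exists (C * (\prod_(k < N | k != j) hl_pair a i k *
      ((\prod_(k < N | k != i) hl_pair a j k) *
       \prod_(l < N | (l != i) && (l != j)) \prod_(k < N) hl_pair a l k))).
    by rewrite [RHS]mulrA -defC; ring.
  by exists ((\prod_(k < N) 'X_k ^+ nth 0%N a k) * C); rewrite mulrCA.
have neq0 := mpolyX_sub_neq0 neq_ij.
have antiM : msym (tperm i j) M = - M.
  apply: (mulfI neq0); have := msym_hl_num (tperm i j) ss.
  rewrite defM msymM msymB {1 2}/msym !mmapX !mmap1U tpermL tpermR => e.
  by rewrite mulrN -e -mulNr opprB.
(* Swapping [x_i] and [x_j] is invisible after identifying them, so the image of [M] equals its own
   opposite and vanishes because 2 is nonzero. *)
have /mpoly_ident_eq0[C defC] : mpoly_ident i j M = 0.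
  have /eqP := mpoly_ident_tperm i j M; rewrite antiM rmorphN /= eq_sym -subr_eq0 opprK.
  rewrite -mulr2n -mulr_natl mulf_eq0 => /orP[|/eqP//].
  by rewrite -(rmorph_nat (@mpolyC N R)) mpolyC_eq0 (negPf R2).
by exists C; rewrite defM defC mulrA.
Qed.

(** The factors for [(i, j)] and [(j, i)] multiply to minus a square. *)
Lemma hl_prod0E N : hl_prod N [::] =
  \prod_(p : 'I_N * 'I_N | (p.1 < p.2)%N) - ('X_p.1 - 'X_p.2) ^+ 2.
Proof.
rewrite /hl_prod pair_big /= (bigID (fun p : 'I_N * 'I_N => (p.1 < p.2)%N)) /=.
have -> : \prod_(p : 'I_N * 'I_N | ~~ (p.1 < p.2)%N) hl_pair [::] p.1 p.2 =
          \prod_(p : 'I_N * 'I_N | (p.2 < p.1)%N) hl_pair [::] p.1 p.2.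
  rewrite big_mkcond [RHS]big_mkcond; apply: eq_bigr => -[i j] _ /=.
  by rewrite hl_pair0 -val_eqE; case: ltngtP.
rewrite [X in _ * X](reindex_inj (h := fun p : 'I_N * 'I_N => (p.2, p.1))) /=; last first.
  by move=> [i j] [k l] [-> ->].
rewrite -big_split; apply: eq_bigr => -[i j] /= ltij.
by rewrite !hl_pair0 -!val_eqE; case: ltngtP ltij => // _ _; ring.
Qed.

Lemma hl_prod0_dvd N (s : seq nat) : (2 : R) != 0 -> size s = N ->
  exists p, hl_num N s = p * hl_prod N [::].
Proof.
move=> R2 ss.
pose e := [seq p : 'I_N * 'I_N <- enum {: 'I_N * 'I_N} | (p.1 < p.2)%N].
have [| | | | |C defC] := @prod_sqr_dvd {mpoly R[N]} ('I_N * 'I_N)%type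
  (fun p => 'X_p.1 - 'X_p.2) (fun p => mpoly_ident p.1 p.2) e (hl_num N s).
- by rewrite filter_uniq ?enum_uniq.
- by move=> p q _; apply: mpoly_ident_eq0.
- move=> p; rewrite mem_filter => /andP[ltp _].
  by rewrite rmorphB /= !mpoly_identX eqxx; case: ifP; rewrite subrr.
(* As [i < j] and [k < l], setting [x_i := x_j] can kill [x_k - x_l] only when the two pairs
   coincide. *)
- move=> [i j] [k l]; rewrite !mem_filter /= => /andP[ltij _] /andP[ltkl _].
  rewrite rmorphB /= !mpoly_identX => neq; apply: mpolyX_sub_neq0.
  case: (eqVneq k i) => [ki|ki]; case: (eqVneq l i) => [li|li].
  + by move: ltkl; rewrite ki li ltnn.
  + by apply: contra neq => /eqP <-; rewrite ki.
  + by apply: contraTneq ltkl => ->; rewrite li -leqNgt ltnW.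
  + by apply: contraTneq ltkl => ->; rewrite ltnn.
- move=> p; rewrite mem_filter => /andP[ltp _].
  by apply: hl_num_sqr_dvd => //; rewrite -val_eqE ltn_eqF.
(* The sign collects the minus signs of the squares, one for each pair. *)
rewrite hl_prod0E prodrN; set k := #|_|; exists (C * (-1) ^+ k).
rewrite mulrA -[_ * _ * (-1) ^+ k]mulrA -expr2 sqrr_sign mulr1 mulrC defC; congr (_ * _).
by rewrite /e big_filter big_enum_cond.
Qed.
End HLNumerator.

(** * Setting the last variable to zero *)

Section Stability.
Variables (R : idomainType) (t : R).

(** The substitution [x_N := 0]: [insub] fails exactly at the last index. *)
Definition mpoly_restr N : {mpoly R[N.+1]} -> {mpoly R[N]} :=
  mmap (@mpolyC N R) (fun i : 'I_N.+1 => if insub (i : nat) is Some k then 'X_k else 0).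
HB.instance Definition _ N := GRing.RMorphism.on (@mpoly_restr N).

Lemma mpoly_restrC N c : mpoly_restr c%:MP = c%:MP_[N].
Proof. by rewrite /mpoly_restr mmapC. Qed.

Lemma mpoly_restr_widen N (i : 'I_N) :
  mpoly_restr 'X_(widen_ord (leqnSn N) i) = 'X_i.
Proof. by rewrite /mpoly_restr mmapX mmap1U /= valK. Qed.

Lemma mpoly_restr_max N : mpoly_restr 'X_ord_max = 0 :> {mpoly R[N]}.
Proof. by rewrite /mpoly_restr mmapX mmap1U insubN // ltnn. Qed.

Lemma mcoeff_restr N (p : {mpoly R[N.+1]}) m : (mpoly_restr p)@_m = p@_(mnmwiden m).
Proof.
elim/mpolyind: p => [|c m' p _ _ IHp]; first by rewrite rmorph0 !mcoeff0.
rewrite rmorphD !mcoeffD IHp; congr (_ + _).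
rewrite -mul_mpolyC rmorphM /= mpoly_restrC !mcoeffCM mcoeffX; congr (_ * _).
rewrite mpolyXE_id rmorph_prod big_ord_recr /= rmorphXn /= mpoly_restr_max.
pose m1 := [multinom m' (widen_ord (leqnSn N) i) | i < N].
rewrite (eq_bigr (fun i : 'I_N => 'X_i ^+ m1 i)); last first.
  by move=> i _; rewrite rmorphXn /= mpoly_restr_widen mnmE.
rewrite -mpolyXE_id expr0n.
have -> : (m' == mnmwiden m) = (m1 == m) && (m' ord_max == 0%N).
  apply/eqP/andP => [e|[/eqP <- /eqP m0]].
    rewrite e mnmwiden_ordmax; split=> //; apply/eqP/mnmP => i.
    by rewrite mnmE e mnmwiden_widen.
  apply/mnmP => i; case: (unliftP ord_max i) => [k ->|->]; last by rewrite mnmwiden_ordmax.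
  have -> : lift ord_max k = widen_ord (leqnSn N) k.
    by apply: val_inj; rewrite /= /bump leqNgt ltn_ord.
  by rewrite mnmwiden_widen mnmE.
by case: (m' ord_max == 0%N); rewrite ?mulr1 ?mulr0 ?mcoeff0 ?andbF ?andbT // mcoeffX.
Qed.

(** At [x_N = 0] the pairs [(i, N)] and [(N, i)] become [x_i] and [- x_i]: [t] can only multiply
    [x_N], because [a_N = 0] is never the larger exponent. The extra factor is thus the same for all
    such [a]. *)
Lemma restr_hl_prod N (a : seq nat) : nth 0%N a N = 0%N ->
  mpoly_restr (hl_prod t N.+1 a) =
  hl_prod t N a * \prod_(i < N) (- ('X_i ^+ 2)).
Proof.
move=> aN; rewrite rmorph_prod big_ord_recr /=.
have -> : mpoly_restr (\prod_(j < N.+1) hl_pair t a ord_max j) = \prod_(i < N) - 'X_i.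
  rewrite rmorph_prod big_ord_recr /= {2}/hl_pair eqxx rmorph1 mulr1.
  apply: eq_bigr => i _; rewrite /hl_pair -val_eqE /= gtn_eqF // aN ltn0.
  by rewrite rmorphB /= mpoly_restr_max mpoly_restr_widen sub0r.
rewrite -big_split -big_split; apply: eq_bigr => i _ /=.
rewrite rmorph_prod big_ord_recr /=.
have -> : mpoly_restr (hl_pair t a (widen_ord (leqnSn N) i) ord_max) = 'X_i.
  rewrite /hl_pair -val_eqE /= ltn_eqF //.
  by case: ifP; rewrite rmorphB ?rmorphM /= mpoly_restr_max mpoly_restr_widen ?mulr0 subr0.
rewrite -mulrA; congr (_ * _); last by rewrite mulrN expr2.
apply: eq_bigr => j _; rewrite /hl_pair -!val_eqE /=; case: ifP; rewrite ?rmorph1 //.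
by case: ifP; rewrite rmorphB ?rmorphM /= !mpoly_restr_widen ?mpoly_restrC.
Qed.

Lemma eq_hl_prod N (a b : seq nat) : {in gtn N, nth 0%N a =1 nth 0%N b} ->
  hl_prod t N a = hl_prod t N b.
Proof.
move=> eqab; apply: eq_bigr => i _; apply: eq_bigr => j _.
by rewrite /hl_pair !eqab ?inE.
Qed.

Lemma permutations_rcons0 N (s : seq nat) : size s = N ->
  perm_eq [seq a <- permutations (rcons s 0%N) | nth 0%N a N == 0%N]
          [seq rcons b 0%N | b <- permutations s].
Proof.
move=> ss; apply: uniq_perm.
- by rewrite filter_uniq ?permutations_uniq.
- rewrite map_inj_uniq ?permutations_uniq //; exact: rcons_injl.
have perm_rcons0 b : perm_eq (rcons b 0%N) (rcons s 0%N) = perm_eq b s.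
  by rewrite perm_rcons perm_sym perm_rcons perm_cons perm_sym.
move=> a; rewrite mem_filter mem_permutations; apply/andP/mapP.
  move=> [aN pa]; case/lastP: a => [|b x] in aN pa *; first by have := perm_size pa;
    rewrite size_rcons.
  have sb : size b = N by have := perm_size pa; rewrite !size_rcons ss => -[].
  move: aN pa; rewrite nth_rcons sb ltnn eqxx => /eqP -> pa.
  by exists b; rewrite // mem_permutations -perm_rcons0.
move=> [b]; rewrite mem_permutations => pb ->; rewrite perm_rcons0 pb.
by rewrite nth_rcons (perm_size pb) ss ltnn eqxx.
Qed.

(** Rearrangements with a positive exponent at [N] are killed by [x_N := 0]; the others are
    rearrangements of [s] followed by 0. *)
Lemma restr_hl_num N (s : seq nat) : size s = N ->
  mpoly_restr (hl_num t N.+1 (rcons s 0%N)) =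
  hl_num t N s * \prod_(i < N) (- ('X_i ^+ 2)).
Proof.
move=> ss; rewrite rmorph_sum (bigID (fun a => nth 0%N a N == 0%N)) /=.
rewrite [X in _ + X]big1 ?addr0 => [|a aN]; last first.
  by rewrite rmorphM rmorph_prod big_ord_recr /= rmorphXn /= mpoly_restr_max expr0n (negPf aN)
    mulr0 mul0r.
rewrite -big_filter (perm_big _ (permutations_rcons0 ss)) big_map mulr_suml /=.
rewrite big_seq [RHS]big_seq; apply: eq_bigr => b; rewrite mem_permutations => pb.
have sb : size b = N by rewrite (perm_size pb).
have nthb : {in gtn N, nth 0%N (rcons b 0%N) =1 nth 0%N b}.
  by move=> i ltiN; rewrite nth_rcons sb [(i < N)%N]ltiN.
rewrite rmorphM /= restr_hl_prod; last by rewrite nth_rcons sb ltnn eqxx.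
rewrite (eq_hl_prod nthb) mulrA; congr (_ * _ * _).
rewrite rmorph_prod big_ord_recr /= nth_rcons sb ltnn eqxx expr0 rmorph1 mulr1.
by apply: eq_bigr => i _; rewrite rmorphXn /= mpoly_restr_widen nthb ?inE.
Qed.

(** Numerator and denominator acquire the same nonzero factor, which cancels. *)
Lemma restr_hl_quotient N (s : seq nat) (p : {mpoly R[N.+1]}) (q : {mpoly R[N]}) :
  size s = N -> hl_num t N.+1 (rcons s 0%N) = p * hl_prod t N.+1 [::] ->
  hl_num t N s = q * hl_prod t N [::] -> mpoly_restr p = q.
Proof.
move=> ss defp defq; have := restr_hl_num ss.
rewrite defp rmorphM /= restr_hl_prod ?nth_nil // defq mulrA.
have E0 : \prod_(i < N) (- ('X_i ^+ 2)) != 0 :> {mpoly R[N]}.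
  apply/prodf_neq0 => i _; rewrite oppr_eq0 expf_eq0 /=.
  by apply/eqP => /(congr1 (mcoeff U_(i)))/eqP; rewrite mcoeffXU mcoeff0 eqxx oner_eq0.
by move=> /(mulIf E0)/(mulIf (hl_prod0_neq0 t N)).
Qed.

End Stability.

Lemma size_prod_leq_sum (A : comNzRingType) (I : finType) (F : I -> {poly A}) (d : I -> nat) :
  (forall i, (size (F i) <= (d i).+1)%N) -> (size (\prod_i F i)%R <= (\sum_i d i).+1)%N.
Proof.
move=> leFd; elim/big_rec2: _ => [|i k p _ IH]; first by rewrite size_poly1.
apply: leq_trans (size_polyMleq _ _) _.
by have := leq_add (leFd i) IH; rewrite addSn addnS; case: (size _ + size _)%N.
Qed.

Lemma size_prod_eq_sum (A : idomainType) (I : finType) (F : I -> {poly A}) (d : I -> nat) :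
  (forall i, size (F i) = (d i).+1) -> size (\prod_i F i) = (\sum_i d i).+1%N.
Proof.
move=> eqFd; elim/big_rec2: _ => [|i k p _ IH]; first by rewrite size_poly1.
by rewrite size_mul -?size_poly_gt0 ?eqFd ?IH // addnS.
Qed.

Lemma size_mulS (A : idomainType) (p q : {poly A}) d :
  p != 0 -> size q = d.+1 -> size (p * q) = (size p + d)%N.
Proof. by move=> p0 sq; rewrite size_mul -?[q == 0]size_poly_eq0 ?sq // addnS. Qed.

(** * Weights of the variables and the exponents of the quotient *)

Section Grading.
Variables (R : idomainType) (t : R) (N : nat) (u : 'I_N -> nat).

(** Multiplies each [x_i] by the power [u i] of a new variable, so that the weighted degree is read
    off as the size of a univariate polynomial. *)
Definition mpoly_grade : {mpoly R[N]} -> {poly {mpoly R[N]}} :=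
  mmap (polyC \o @mpolyC N R) (fun i => ('X_i)%:P * 'X^(u i)).
HB.instance Definition _ := GRing.RMorphism.on mpoly_grade.

Lemma mpoly_gradeC c : mpoly_grade c%:MP = (c%:MP)%:P.
Proof. by rewrite /mpoly_grade mmapC. Qed.

Lemma mpoly_gradeX i : mpoly_grade 'X_i = ('X_i)%:P * 'X^(u i).
Proof. by rewrite /mpoly_grade mmapX mmap1U. Qed.

Lemma mpoly_gradeXm (m : 'I_N -> nat) :
  mpoly_grade (\prod_i 'X_i ^+ m i) =
  (\prod_i 'X_i ^+ m i)%:P * 'X^(\sum_i u i * m i).
Proof.
rewrite !rmorph_prod -prodrXr -big_split; apply: eq_bigr => i _ /=.
by rewrite !rmorphXn /= mpoly_gradeX exprMn exprM.
Qed.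

Lemma mcoeff_grade (p : {mpoly R[N]}) m d :
  ((mpoly_grade p)`_d)@_m = if (\sum_i u i * m i)%N == d then p@_m else 0.
Proof.
elim/mpolyind: p => [|c m' p _ _ IHp]; first by rewrite rmorph0 coef0 !mcoeff0 if_same.
have -> : mpoly_grade (c *: 'X_[m'] + p) = mpoly_grade (c *: 'X_[m']) + mpoly_grade p.
  exact: rmorphD.
rewrite coefD.
rewrite !mcoeffD.
rewrite [X in _ + X = _]IHp.
have -> : mpoly_grade (c *: 'X_[m']) = (c%:MP)%:P * mpoly_grade 'X_[m'].
  by rewrite -mul_mpolyC rmorphM /= mpoly_gradeC.
rewrite coefCM.
rewrite !mcoeffCM.
have -> : mpoly_grade 'X_[m'] = ('X_[m'])%:P * 'X^(\sum_i u i * m' i).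
  by rewrite {1}mpolyXE_id mpoly_gradeXm -mpolyXE_id.
rewrite coefCM coefXn.
have -> : ('X_[m'] * (d == \sum_i u i * m' i)%N%:R : {mpoly R[N]})@_m =
    if (\sum_i u i * m i)%N == d then ('X_[m'] : {mpoly R[N]})@_m else 0.
  rewrite -[(_ == _)%N%:R](rmorph_nat (@mpolyC N R)) mulrC mcoeffCM mcoeffX eq_sym.
  have [->|neq] := eqVneq m' m; last by rewrite mulr0 if_same.
  by case: eqP; rewrite ?mul1r ?mul0r.
by case: eqP => _; rewrite ?mcoeffZ ?mulr0 ?addr0.
Qed.

Lemma size_grade_gt (p : {mpoly R[N]}) m :
  p@_m != 0 -> (\sum_i u i * m i < size (mpoly_grade p))%N.
Proof.
rewrite ltnNge; apply: contra => /leq_sizeP/(_ _ (leqnn _)) pm0.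
by have := mcoeff_grade p m (\sum_i u i * m i)%N; rewrite pm0 mcoeff0 eqxx => <-.
Qed.

Definition pair_weight (i j : 'I_N) := if i == j then 0%N else maxn (u i) (u j).

(** Only an inequality: for [t = 0] the term of larger weight may be absent. *)
Lemma size_grade_pair (a : seq nat) (i j : 'I_N) :
  (size (mpoly_grade (hl_pair t a i j)) <= (pair_weight i j).+1)%N.
Proof.
rewrite /hl_pair /pair_weight; case: eqP => _; first by rewrite rmorph1 size_poly1.
have szX (c : {mpoly R[N]}) k : (size (c%:P * 'X^(u k))%R <= (u k).+1)%N.
  by rewrite mul_polyC (leq_trans (size_scale_leq _ _)) // size_polyXn.
case: ifP => _; rewrite rmorphB ?rmorphM /= ?mpoly_gradeC !mpoly_gradeX ?mulrA -?polyCM.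
all: rewrite (leq_trans (size_polyD _ _)) // size_polyN geq_max.
all: by rewrite !(leq_trans (szX _ _)) // ltnS ?leq_maxl ?leq_maxr.
Qed.

(** Without [t] the bound is attained: even if both weights agree, the two terms involve distinct
    variables and cannot cancel. *)
Lemma size_grade_pair0 (i j : 'I_N) :
  size (mpoly_grade (hl_pair t [::] i j)) = (pair_weight i j).+1.
Proof.
apply/eqP; rewrite eqn_leq size_grade_pair ltnNge; apply/negP => /leq_sizeP.
move/(_ _ (leqnn _)); rewrite hl_pair0 /pair_weight; case: eqVneq => [_|neq].
  by rewrite rmorph1 coef1 => /eqP; rewrite oner_eq0.
rewrite rmorphB /= !mpoly_gradeX coefB !coefCM !coefXn => e.
have [e1|e1] : maxn (u i) (u j) = u i \/ maxn (u i) (u j) = u j.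
- by case: (leqP (u i) (u j)); [right|left].
- move/(congr1 (mcoeff U_(i)))/eqP: e; rewrite e1 eqxx mulr1 mcoeffB mcoeff0 mcoeffXU eqxx.
  rewrite -[(_ == _)%:R](rmorph_nat (@mpolyC N R)) mulrC mcoeffCM mcoeffXU.
  by rewrite [j == i]eq_sym (negPf neq) mulr0 subr0 oner_eq0.
move/(congr1 (mcoeff U_(j)))/eqP: e; rewrite e1 eqxx mulr1 mcoeffB mcoeff0 mcoeffXU eqxx.
rewrite -[(_ == _)%:R](rmorph_nat (@mpolyC N R)) mulrC mcoeffCM mcoeffXU.
by rewrite (negPf neq) mulr0 sub0r oppr_eq0 oner_eq0.
Qed.

(* The exponents of [p] lie in every half-space containing the rearrangements
   of [s], as the fractions in the definition of [hl_frac] have degree zero. *)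
Lemma hl_quotient_weight (s : seq nat) (p : {mpoly R[N]}) (B : nat) m :
  hl_num t N s = p * hl_prod t N [::] ->
  (forall a, perm_eq a s -> (\sum_(i < N) u i * nth 0 a i <= B)%N) ->
  p@_m != 0 -> (\sum_i u i * m i <= B)%N.
Proof.
move=> defp leB pm; rewrite -ltnS (leq_trans (size_grade_gt pm)) //.
(* [D] is the exact degree of the denominator, while the numerator has degree at most [B + D];
   degrees add up in a domain, leaving at most [B] for [p]. *)
pose D := (\sum_i \sum_j pair_weight i j)%N.
have sV : size (mpoly_grade (hl_prod t N [::])) = D.+1.
  rewrite rmorph_prod (size_prod_eq_sum (d := fun i => (\sum_j pair_weight i j)%N)) // => i.
  by rewrite rmorph_prod (size_prod_eq_sum (size_grade_pair0 i)).
have sQ : (size (mpoly_grade (hl_num t N s)) <= (B + D).+1)%N.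
  rewrite rmorph_sum big_seq; apply: (big_ind (fun q : {poly {mpoly R[N]}} => is_true (size q
    <= (B + D).+1)%N)).
  - by rewrite size_poly0.
  - by move=> q1 q2 h1 h2; rewrite (leq_trans (size_polyD _ _)) // geq_max h1.
  move=> a; rewrite mem_permutations => /leB aB.
  rewrite rmorphM /= (mpoly_gradeXm (fun i => nth 0%N a i)) -mulrA mul_polyC.
  rewrite (leq_trans (size_scale_leq _ _)) // (leq_trans (size_polyMleq _ _)) //.
  rewrite size_polyXn addSn /= -addnS leq_add // rmorph_prod.
  apply: (size_prod_leq_sum (d := fun i => (\sum_j pair_weight i j)%N)) => i.
  by rewrite rmorph_prod; apply: size_prod_leq_sum; apply: size_grade_pair.
have p0 : mpoly_grade p != 0 by rewrite -size_poly_gt0 (leq_trans _ (size_grade_gt pm)).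
have gM : mpoly_grade (hl_num t N s) = mpoly_grade p * mpoly_grade (hl_prod t N [::]).
  by rewrite defp; exact: rmorphM.
have e := size_mulS p0 sV.
by move: sQ; rewrite gM e -addSn leq_add2r.
Qed.
End Grading.

Section Degree.
Variables (R : idomainType) (t : R) (N : nat).

(** With all weights equal to 1 every factor is homogeneous, so the grading only multiplies by
    powers of the new variable, and those of the denominator cancel. *)
Lemma hl_quotient_degree (s : seq nat) (p : {mpoly R[N]}) m : size s = N ->
  hl_num t N s = p * hl_prod t N [::] -> p@_m != 0 -> mdeg m = sumn s.
Proof.
move=> ss defp pm.
have [u u1] : exists u : 'I_N -> nat, forall i, u i = 1%N by exists (fun=> 1%N).
pose w (i j : 'I_N) : nat := i != j.
have grade_pair a i j : mpoly_grade u (hl_pair t a i j) = (hl_pair t a i j)%:P * 'X^(w i j).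
  rewrite /hl_pair /w; case: eqP => _; first by rewrite rmorph1 expr0 mulr1.
  case: ifP => _; rewrite polyCB mulrBl expr1.
    rewrite rmorphB rmorphM /= mpoly_gradeC !mpoly_gradeX !u1 expr1.
    by rewrite [in RHS]polyCM mulrA.
  by rewrite rmorphB /= !mpoly_gradeX !u1 expr1.
have grade_prod a : mpoly_grade u (hl_prod t N a) = (hl_prod t N a)%:P * 'X^(\sum_i \sum_j w i j).
  rewrite !rmorph_prod -prodrXr -big_split; apply: eq_bigr => i _ /=.
  rewrite !rmorph_prod -prodrXr -big_split; apply: eq_bigr => j _ /=.
  exact: grade_pair.
have grade_num : mpoly_grade u (hl_num t N s) =
    (hl_num t N s)%:P * 'X^(sumn s) * 'X^(\sum_i \sum_j w i j).
  rewrite !rmorph_sum !mulr_suml big_seq [RHS]big_seq; apply: eq_bigr => a.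
  rewrite mem_permutations => pa; rewrite !rmorphM /= grade_prod.
  rewrite (@mpoly_gradeXm R N u (fun i => nth 0%N a i)) /=.
  have -> : (\sum_(i < N) u i * nth 0 a i = sumn s)%N.
    rewrite -(perm_sumn pa) sumnE (big_nth 0%N) big_mkord (perm_size pa) ss.
    by apply: eq_bigr => i _; rewrite u1 mul1n.
  by rewrite -!mulrA; congr (_ * _); rewrite mulrCA.
have z0 : 'X^(\sum_i \sum_j w i j) != 0 :> {poly {mpoly R[N]}}.
  by rewrite -size_poly_eq0 size_polyXn.
have V0 : (hl_prod t N [::])%:P != 0 by rewrite polyC_eq0 hl_prod0_neq0.
have gp : mpoly_grade u p = p%:P * 'X^(sumn s).
  apply: (mulIf V0); apply: (mulIf z0).
  have gM : mpoly_grade u (hl_num t N s) = mpoly_grade u p * mpoly_grade u (hl_prod t N [::]).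
    by rewrite defp; exact: rmorphM.
  rewrite -mulrA -grade_prod -gM grade_num defp polyCM; congr (_ * _).
  by rewrite mulrAC.
have um : (\sum_i u i * m i)%N = mdeg m.
  by rewrite mdegE; apply: eq_bigr => i _; rewrite u1 mul1n.
have := mcoeff_grade u p m (mdeg m); rewrite gp coefCM coefXn um eqxx.
by case: eqP => // _; rewrite mulr0 mcoeff0 => /eqP; rewrite eq_sym (negPf pm).
Qed.

End Degree.

(** * Change of coefficients and the value at [t = 1] *)

Section Specialization.
Variable N : nat.

Lemma map_hl_pair (R S : idomainType) (h : {rmorphism R -> S}) (t : R) a (i j : 'I_N) :
  map_mpoly h (hl_pair t a i j) = hl_pair (h t) a i j.
Proof.
rewrite /hl_pair; case: eqP => _; first by rewrite rmorph1.
by case: ifP => _; rewrite rmorphB ?rmorphM /= ?map_mpolyC !map_mpolyX.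
Qed.

Lemma map_hl_prod (R S : idomainType) (h : {rmorphism R -> S}) (t : R) a :
  map_mpoly h (hl_prod t N a) = hl_prod (h t) N a.
Proof.
rewrite rmorph_prod; apply: eq_bigr => i _; rewrite rmorph_prod.
by apply: eq_bigr => j _; apply: map_hl_pair.
Qed.

Lemma map_hl_num (R S : idomainType) (h : {rmorphism R -> S}) (t : R) s :
  map_mpoly h (hl_num t N s) = hl_num (h t) N s.
Proof.
rewrite rmorph_sum; apply: eq_bigr => a _; rewrite rmorphM /= map_hl_prod rmorph_prod.
by congr (_ * _); apply: eq_bigr => i _; rewrite rmorphXn /= map_mpolyX.
Qed.

(** Once [t] becomes 1, [hl_prod] no longer depends on [a] and cancels against the denominator,
    leaving the sum of the monomials of the distinct rearrangements of [s]. *)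
Lemma hl_quotient_spec1 (R S : idomainType) (h : {rmorphism R -> S}) (t : R) s p m :
  h t = 1 -> size s = N -> hl_num t N s = p * hl_prod t N [::] ->
  h p@_m = (perm_eq [seq m i | i : 'I_N] s)%:R.
Proof.
move=> ht1 ss /(congr1 (map_mpoly h)).
rewrite map_hl_num rmorphM /= map_hl_prod ht1 /hl_num.
under eq_bigr => a _.
  rewrite (_ : hl_prod 1 N a = hl_prod 1 N [::]); first over.
  apply: eq_bigr => i _; apply: eq_bigr => j _.
  by rewrite hl_pair0 /hl_pair; case: eqP => // _; case: ifP => _; rewrite ?mpolyC1 ?mul1r.
rewrite -mulr_suml => /(mulIf (hl_prod0_neq0 1 N))/esym defp.
rewrite -mcoeff_map_mpoly defp raddf_sum /=.
transitivity (\sum_(a <- permutations s) (a == [seq m i | i : 'I_N])%:R : S).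
  rewrite big_seq [RHS]big_seq; apply: eq_bigr => a; rewrite mem_permutations => /perm_size sa.
  pose ma := [multinom nth 0%N a i | i < N].
  rewrite (eq_bigr (fun i : 'I_N => 'X_i ^+ ma i)) => [|i _]; last by rewrite mnmE.
  rewrite -mpolyXE_id mcoeffX; congr ((nat_of_bool _)%:R); apply/eqP/eqP => [<-|e].
    by rewrite -[LHS](@map_nth_enum N) ?sa //; apply: eq_map => i; rewrite mnmE.
  by apply/mnmP => i; rewrite mnmE e nth_enum_map.
rewrite -natr_sum -mem_permutations -(count_uniq_mem _ (permutations_uniq s)) -sum1_count.
by rewrite [in RHS]big_mkcond; congr (_%:R); apply: eq_bigr => a _ /=; case: eqP.
Qed.
End Specialization.

(** * Partial sums, padding by zeros, and exponents of multisets *)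

Lemma eq_ord_image N (T : Type) (f g : 'I_N -> T) : f =1 g ->
  [seq f i | i : 'I_N] = [seq g i | i : 'I_N].
Proof. by move=> efg; apply: eq_map. Qed.

Lemma sumn_nth N (a : seq nat) : (size a <= N)%N -> sumn a = (\sum_(i < N) nth 0 a i)%N.
Proof.
move=> leaN; rewrite sumnE (big_nth 0%N) big_mkord (big_ord_widen N (fun i => nth 0 a i)%N) //.
rewrite big_mkcond; apply: eq_bigr => i _.
by case: ltnP => // le_ai; rewrite nth_default.
Qed.

(** Writes a partial sum as a weight with 0/1 coefficients, the form in which the degree bound on
    the quotient gives dominance. *)
Lemma sumn_take N k (a : seq nat) : (size a <= N)%N ->
  sumn (take k a) = (\sum_(i < N) (i < k)%N * nth 0 a i)%N.
Proof.
move=> leaN; rewrite (@sumn_nth N) ?size_take_min ?geq_min ?leaN ?orbT //.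
apply: eq_bigr => i _; have [ltik|leki] := ltnP i k; first by rewrite nth_take // mul1n.
by rewrite mul0n nth_default // size_take_min geq_min leki.
Qed.

(* Compare both sides with the threshold [v = s_k]: a term [x] is at most
   [v + (x - v)], with equality when [x >= v]. *)
Lemma sumn_take_sorted k (a s : seq nat) : sorted geq s -> perm_eq a s ->
  (sumn (take k a) <= sumn (take k s))%N.
Proof.
move=> sorted_s pas; have sas := perm_size pas.
have [les|ltks] := leqP (size s) k.
  by rewrite !take_oversize ?sas // (perm_sumn pas).
pose v := nth 0%N s k.
have sz b : size b = size s -> size (take k b) = k.
  by move=> sb; rewrite size_take sb ltks.
have sumD (b : seq nat) : (\sum_(x <- b) (v + (x - v)) = size b * v + \sum_(x <- b) (x - v))%N.
  by rewrite big_split /= big_const_seq count_predT iter_addn_0 mulnC.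
have ge_trans : transitive geq by move=> x y z /= yx xz; exact: leq_trans xz yx.
have nth_ge i j : (i <= j)%N -> (j < size s)%N -> (nth 0 s j <= nth 0 s i)%N.
  move=> leij ltj.
  apply: (sorted_leq_nth ge_trans (fun x => leqnn x) 0%N sorted_s) => //.
  by rewrite inE (leq_ltn_trans leij).
apply: (@leq_trans (\sum_(x <- take k a) (v + (x - v)))%N).
  by rewrite sumnE; apply: leq_sum => x _; rewrite -maxnE leq_maxr.
rewrite sumD sz //.
apply: (@leq_trans (k * v + \sum_(x <- a) (x - v))%N).
  by rewrite leq_add2l -{2}(cat_take_drop k a) big_cat leq_addr.
rewrite (perm_big _ pas) -[X in (_ + \sum_(x <- X) _ <= _)%N](cat_take_drop k s) big_cat.
(* Entries of [s] from position [k] on are at most [v], so their truncated differences are 0. *)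
rewrite [X in (_ + (_ + X))%N]big1_seq ?addn0; last first.
  move=> x /= /(nthP 0%N)[i]; rewrite size_drop nth_drop => lti <-.
  by apply/eqP; rewrite subn_eq0; apply: nth_ge; rewrite ?leq_addr // -ltn_subRL.
rewrite -{1}(sz _ s) // -sumD sumnE big_seq [X in (_ <= X)%N]big_seq.
apply: leq_sum => x /(nthP 0%N)[i]; rewrite sz // => lti; rewrite nth_take // => <-.
by rewrite subnKC // nth_ge // ltnW.
Qed.

Definition zero_pad N (s : seq nat) : seq nat := s ++ nseq (N - size s) 0%N.

Lemma size_zero_pad N s : (size s <= N)%N -> size (zero_pad N s) = N.
Proof. by move=> les; rewrite size_cat size_nseq subnKC. Qed.

Lemma zero_padS N s : (size s <= N)%N -> zero_pad N.+1 s = rcons (zero_pad N s) 0%N.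
Proof.
move=> les; rewrite /zero_pad subSn // -cats1 -catA; congr (_ ++ _).
by rewrite -[[:: 0%N]]/(nseq 1 0%N) -nseqD addn1.
Qed.

Lemma sumn_zero_pad N s : sumn (zero_pad N s) = sumn s.
Proof. by rewrite sumn_cat sumn_nseq mul0n addn0. Qed.

Lemma sorted_zero_pad N s : sorted geq s -> sorted geq (zero_pad N s).
Proof.
have ge_trans : transitive geq by move=> x y z /= yx xz; exact: leq_trans xz yx.
move=> ss; rewrite (sorted_pairwise ge_trans) pairwise_cat -(sorted_pairwise ge_trans) ss /=.
apply/andP; split.
  by apply/allrelP => x y _; rewrite mem_nseq => /andP[_ /eqP ->] /=.
by elim: (N - size s)%N => //= k ->; rewrite andbT all_nseq /= leqnn orbT.
Qed.

Lemma perm_zero_pad N (a s : seq nat) : size a = N -> (size s <= N)%N -> 0%N \notin s ->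
  perm_eq a (zero_pad N s) = perm_eq [seq x <- a | x != 0%N] s.
Proof.
move=> sa les s0.
have fs : [seq x <- s | x != 0%N] = s.
  by apply/all_filterP/allP => x xs; apply: contraNneq s0 => <-.
apply/idP/idP => [/(perm_filter (fun x => x != 0%N))|pf].
  by rewrite filter_cat fs filter_nseq /= cats0.
rewrite -(perm_filterC (fun x => x != 0%N) a) /zero_pad perm_cat //.
have : all (pred1 0%N) [seq x <- a | predC (fun x => x != 0%N) x].
  by apply/allP => x; rewrite mem_filter /= negbK => /andP[].
move=> /all_pred1P ->; rewrite size_filter;
  suff -> : count (predC (fun x => x != 0%N)) a = (N - size s)%N by [].
by rewrite -(perm_size pf) size_filter -sa -(count_predC (fun x => x != 0%N) a) addKn.
Qed.

Lemma perm_finsupp N (m : {mset nat}) : (forall i, (N <= i)%N -> m i = 0%N) ->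
  perm_eq [seq x <- [seq m i | i : 'I_N] | x != 0%N] [seq m i | i <- finsupp m].
Proof.
move=> mN; have -> : [seq m i | i : 'I_N] = [seq m i | i <- iota 0 N].
  by rewrite -val_enum_ord -map_comp.
rewrite filter_map; apply: perm_map; apply: uniq_perm;
  rewrite ?filter_uniq ?iota_uniq ?fset_uniq //.
move=> i; rewrite mem_filter mem_iota /= add0n mem_finsupp.
by case: (ltnP i N) => [_|/mN /eqP mi]; rewrite ?andbT // mi andbF.
Qed.

Definition mset_bound (m : {mset nat}) := \max_(i <- finsupp m) i.+1.

Lemma mset_boundP m i : (mset_bound m <= i)%N -> m i = 0%N.
Proof.
move=> lei; apply/eqP; apply: contraLR lei => mi; rewrite -ltnNge /mset_bound.
by apply: (@leq_bigmax_seq _ (enum_fset (finsupp m)) xpredT (fun i => i.+1) i);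
  rewrite // mem_finsupp.
Qed.

(** * Hall-Littlewood polynomials and their stable limit *)

Definition hl_poly (la : seq nat) N : {mpoly {poly int}[N]} :=
  classical_sets.xget 0
    (fun p => hl_num 'X N (zero_pad N la) = p * hl_prod 'X N [::]).

Section HallLittlewood.
Variables (la : seq nat) (N : nat).
Hypothesis leN : (size la <= N)%N.

Lemma hl_polyP : hl_num 'X N (zero_pad N la) = hl_poly la N * hl_prod 'X N [::].
Proof.
apply: (classical_sets.xgetPex 0 (P := fun p => hl_num 'X N (zero_pad N la) = p * hl_prod 'X N
  [::])).
by apply: hl_prod0_dvd; rewrite ?size_zero_pad // -polyC_natr polyC_eq0.
Qed.

(** Each fraction absorbs its denominator [x_i - x_j]; pairs without a fraction keep that factor in
    the numerator. *)
Lemma hl_frac_mul (s : seq nat) : hl_frac N s * tofrac (hl_prod 'X N [::]) =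
  tofrac (hl_num 'X N (zero_pad N s)).
Proof.
rewrite /hl_frac mulr_suml rmorph_sum; apply: eq_bigr => a _.
rewrite rmorphM -mulrA; congr (_ * _).
  by rewrite rmorph_prod; apply: eq_bigr => i _; rewrite rmorphXn.
rewrite !rmorph_prod -big_split; apply: eq_bigr => i _ /=.
rewrite !rmorph_prod [X in X * _]big_mkcond -big_split; apply: eq_bigr => j _ /=.
rewrite hl_pair0 /hl_pair; have [->|neq] := eqVneq i j; first by rewrite ltnn rmorph1 mulr1.
case: ifP => _; last by rewrite mul1r.
by rewrite !rmorphB rmorphM /= mulfVK // -rmorphB tofrac_eq0 mpolyX_sub_neq0.
Qed.

Lemma tofrac_hl_poly : tofrac (hl_poly la N) = hl_frac N la.
Proof.
have V0 : tofrac (hl_prod 'X N [::]) != 0 :> {fraction {mpoly {poly int}[N]}}.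
  by rewrite tofrac_eq0 hl_prod0_neq0.
by apply: (mulIf V0); rewrite hl_frac_mul hl_polyP rmorphM.
Qed.

(** The quotient is symmetric because numerator and denominator are. *)
Lemma mcoeff_hl_poly_perm (m1 m2 : 'X_{1..N}) :
  perm_eq [seq m1 i | i : 'I_N] [seq m2 i | i : 'I_N] ->
  (hl_poly la N)@_m1 = (hl_poly la N)@_m2.
Proof.
move=> /(@tuple_permP _ _ _ [tuple m2 i | i < N])[s e].
have -> : m1 = [multinom m2 (s i) | i < N].
  apply/mnmP => i; rewrite mnmE.
  by have := congr1 (fun w => nth 0%N w i) e; rewrite nth_enum_map => ->;
    rewrite nth_enum_map tnth_mktuple.
rewrite -mcoeff_sym; congr (_@__).
apply: (mulIf (hl_prod0_neq0 'X N)); rewrite -{1}(msym_hl_prod0 'X s) -msymM -hl_polyP.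
by rewrite msym_hl_num ?size_zero_pad.
Qed.
End HallLittlewood.

(** One variable is added at a time; it has exponent 0 in [m], so the coefficient survives setting
    it to zero. *)
Lemma mcoeff_hl_poly_stable (la : seq nat) (m : {mset nat}) N1 N2 :
  (size la <= N1)%N -> (forall i, (N1 <= i)%N -> m i = 0%N) -> (N1 <= N2)%N ->
  (hl_poly la N1)@_[multinom m i | i < N1] = (hl_poly la N2)@_[multinom m i | i < N2].
Proof.
move=> leN1 mN1 /subnKC <-; elim: (N2 - N1)%N => [|k IHk]; first by rewrite addn0.
rewrite addnS IHk; set N := (N1 + k)%N.
have leN : (size la <= N)%N by rewrite (leq_trans leN1) ?leq_addr.
have -> : [multinom m i | i < N.+1] = mnmwiden [multinom m i | i < N].
  apply/mnmP => i; case: (unliftP ord_max i) => [j ->|->].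
    have -> : lift ord_max j = widen_ord (leqnSn N) j.
      by apply: val_inj; rewrite /= /bump leqNgt ltn_ord.
    by rewrite mnmwiden_widen !mnmE.
  by rewrite mnmwiden_ordmax mnmE /= mN1 // leq_addr.
have defS := hl_polyP (leqW leN); rewrite zero_padS // in defS.
by rewrite -mcoeff_restr (restr_hl_quotient (size_zero_pad leN) defS (hl_polyP leN)).
Qed.

Lemma is_hall_littlewood_ex (la : seq nat) : exists F, is_hall_littlewood la F.
Proof.
(* The number of variables depends on [m]: enough for all parts of [la] and all indices occurring in
   [m]. *)
exists (fun m => let N := maxn (size la) (mset_bound m) in
  (hl_poly la N)@_[multinom m i | i < N]) => N leN.
exists (hl_poly la N); split; first exact: tofrac_hl_poly.
move=> m mN; cbv zeta; set N0 := maxn _ _.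
(* Neither of [N] and [N0] need be the larger, so both are compared with their maximum. *)
rewrite (@mcoeff_hl_poly_stable la m N0 (maxn N N0)) ?leq_maxl ?leq_maxr //; last first.
  by move=> i lei; apply: mset_boundP; apply: leq_trans lei; rewrite leq_maxr.
by rewrite -(@mcoeff_hl_poly_stable la m N) ?leq_maxl.
Qed.

Lemma hall_littlewoodE (la : seq nat) N (m : {mset nat}) :
  (size la <= N)%N -> (forall i, (N <= i)%N -> m i = 0%N) ->
  hall_littlewood la m = (hl_poly la N)@_[multinom m i | i < N].
Proof.
move=> leN mN; have /(_ N leN)[p [ep ->//]] : is_hall_littlewood la (hall_littlewood la).
  exact: (classical_sets.xgetPex _ (is_hall_littlewood_ex la)).
by congr (_@__); apply/eqP; rewrite -tofrac_eq ep tofrac_hl_poly.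
Qed.

(** * Expansion in monomial symmetric functions *)

Section Triangularity.
Variable n : nat.
Implicit Types (la mu : intpart n) (m : {mset nat}).

Lemma intpart_sorted mu : sorted geq mu. Proof. by case/and3P: (intpartP mu). Qed.
Lemma intpart_notin0 mu : 0%N \notin (mu : seq nat). Proof. by case/and3P: (intpartP mu). Qed.
Lemma intpart_sumn mu : sumn mu = n. Proof. by case/and3P: (intpartP mu) => _ _ /eqP. Qed.

Lemma intpart_perm_inj (mu nu : intpart n) : perm_eq mu nu -> mu = nu.
Proof.
move=> pmn; apply: val_inj; apply: (@sorted_eq _ geq) => //; try exact: intpart_sorted.
  by move=> x y z /= yx xz; exact: leq_trans xz yx.
by move=> x y /= /andP[xy yx]; apply/eqP; rewrite eqn_leq xy yx.
Qed.

Fact mset_of_part_key : unit. Proof. exact: tt. Qed.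
(** The exponents of the monomial with exponent [mu_i] at [x_i], at which the coefficient of [m_mu]
    is read off. *)
Definition mset_of_part (mu : seq nat) : {mset nat} :=
  [mset[mset_of_part_key] i in [fset i in iota 0 (size mu)]%fset => nth 0%N mu i].

Lemma mset_of_partE (mu : seq nat) i : mset_of_part mu i = nth 0%N mu i.
Proof.
rewrite fsfunE inE /= mem_iota add0n /=.
by case: ltnP => // lei; rewrite nth_default.
Qed.

Lemma mset_of_part0 (mu : seq nat) N : (size mu <= N)%N ->
  forall i, (N <= i)%N -> mset_of_part mu i = 0%N.
Proof. by move=> leN i lei; rewrite mset_of_partE nth_default ?(leq_trans leN). Qed.

Definition mset_type (m : {mset nat}) : seq nat := [seq m i | i <- finsupp m].

Lemma mset_type_pad mu m N : (size mu <= N)%N -> (forall i, (N <= i)%N -> m i = 0%N) ->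
  perm_eq [seq m i | i : 'I_N] (zero_pad N (parts mu)) = perm_eq (mset_type m) mu.
Proof.
move=> leN mN; rewrite perm_zero_pad ?size_image ?card_ord ?intpart_notin0 //.
exact: (permPl (perm_finsupp mN)).
Qed.

Lemma mset_type_of_part mu : perm_eq (mset_type (mset_of_part mu)) mu.
Proof.
rewrite -(@mset_type_pad mu _ (size mu)) //; last exact: mset_of_part0.
rewrite /zero_pad subnn cats0 (_ : [seq _ | _ : _] = mu) //.
rewrite -[RHS](map_nth_enum (erefl (size mu))).
by apply: eq_map => i; rewrite mset_of_partE.
Qed.

Lemma hall_littlewood_sym la (m1 m2 : {mset nat}) mu :
  perm_eq (mset_type m1) mu -> perm_eq (mset_type m2) mu ->
  hall_littlewood la m1 = hall_littlewood la m2.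
Proof.
move=> p1 p2; pose N := maxn (maxn (size la) (size mu)) (maxn (mset_bound m1) (mset_bound m2)).
have [leN leNmu] : (size la <= N)%N /\ (size mu <= N)%N by rewrite /N !leq_max !leqnn ?orbT.
have N1 i : (N <= i)%N -> m1 i = 0%N.
  by move=> lei; apply: mset_boundP; apply: leq_trans lei; rewrite !leq_max leqnn ?orbT.
have N2 i : (N <= i)%N -> m2 i = 0%N.
  by move=> lei; apply: mset_boundP; apply: leq_trans lei; rewrite !leq_max leqnn ?orbT.
rewrite (hall_littlewoodE leN N1) (hall_littlewoodE leN N2).
apply: mcoeff_hl_poly_perm => //.
rewrite (eq_ord_image (g := fun i : 'I_N => m1 i)) => [|i]; last by rewrite mnmE.
rewrite [X in perm_eq _ X](eq_ord_image (g := fun i : 'I_N => m2 i)) => [|i]; last by rewrite mnmE.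
rewrite -(mset_type_pad leNmu N1) in p1; rewrite -(mset_type_pad leNmu N2) in p2.
by rewrite (perm_trans p1) // perm_sym.
Qed.

Lemma hall_littlewood_degree la m : hall_littlewood la m != 0 -> sumn (mset_type m) = n.
Proof.
pose N := maxn (size la) (mset_bound m).
have leN : (size la <= N)%N by rewrite leq_maxl.
have mN i : (N <= i)%N -> m i = 0%N.
  by move=> lei; apply: mset_boundP; apply: leq_trans lei; rewrite leq_maxr.
rewrite (hall_littlewoodE leN mN) => /(hl_quotient_degree (size_zero_pad leN) (hl_polyP leN)).
rewrite sumn_zero_pad intpart_sumn mdegE => <-.
rewrite -(perm_sumn (perm_finsupp mN)) sumn_filter big_map big_enum_cond /= big_mkcond.
by apply: eq_bigr => i _; rewrite mnmE; case: eqP => // ->.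
Qed.

(** For each [k], give weight 1 to the first [k] variables and 0 to the others: a rearrangement of
    [la] has weight at most the sum of its [k] largest parts. *)
Lemma hall_littlewood_dominated la mu :
  hall_littlewood la (mset_of_part mu) != 0 -> dominated mu la.
Proof.
pose N := maxn (size la) (size mu).
have leN : (size la <= N)%N by rewrite leq_maxl.
have leNmu : (size mu <= N)%N by rewrite leq_maxr.
rewrite (hall_littlewoodE leN (mset_of_part0 leNmu)) => nz; apply/forallP => k.
have leB a : perm_eq a (zero_pad N la) ->
    (\sum_(i < N) (i < k)%N * nth 0 a i <= sumn (take k la))%N.
  move=> pa; have sa : size a = N by rewrite (perm_size pa) size_zero_pad.
  rewrite -(@sumn_take N k a) ?sa // (@sumn_take N k la) //.
  have nth_pad i : nth 0%N la i = nth 0%N (zero_pad N la) i.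
    rewrite nth_cat nth_nseq; case: ltnP => // lei.
    by rewrite nth_default ?if_same.
  under [X in (_ <= X)%N]eq_bigr do rewrite nth_pad.
  rewrite -sumn_take ?size_zero_pad //.
  by apply: sumn_take_sorted => //; apply/sorted_zero_pad/intpart_sorted.
apply: leq_trans (hl_quotient_weight (hl_polyP leN) leB nz).
by rewrite (sumn_take k leNmu); apply: leq_sum => i _; rewrite mnmE mset_of_partE.
Qed.

Lemma hall_littlewood_expand la m : hall_littlewood la m =
  \sum_(mu : intpart n | dominated mu la)
     hall_littlewood la (mset_of_part mu) * monomial_sym _ mu m.
Proof.
(* If the exponents of [m] sum to [n], sorting them gives the only [mu] that can contribute;
   otherwise both sides vanish. *)
have [|/negP nz] := boolP (sumn (mset_type m) == n).
  move=> /eqP sm; have pm : is_intpart n (sort geq (mset_type m)).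
    apply/and3P; split.
    - by apply: sort_sorted => x y; rewrite orbC; apply: leq_total.
    - by rewrite mem_sort; apply/mapP => -[i]; rewrite mem_finsupp => mi m0; rewrite -m0 eqxx in mi.
    - by rewrite -sm; apply/eqP/perm_sumn; rewrite perm_sort.
  pose mu := IntPart pm.
  have mmu : perm_eq (mset_type m) mu by rewrite perm_sym perm_sort.
  have E nu : monomial_sym {poly int} (parts nu) m = (nu == mu)%:R.
    congr ((nat_of_bool _)%:R); apply/idP/eqP => [mnu|->//].
    by apply: intpart_perm_inj; rewrite perm_sym in mnu; apply: perm_trans mmu.
  under eq_bigr do rewrite E.
  rewrite (hall_littlewood_sym la mmu (mset_type_of_part mu)).
  rewrite (big_mkcond (fun nu => dominated nu la)) (bigD1 mu) //= eqxx mulr1 big1 ?addr0 =>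
    [|nu neq].
    by case: ifPn => //; apply: contraNeq; apply: (@hall_littlewood_dominated la mu).
  by case: ifP; rewrite // (negPf neq) mulr0.
rewrite big1 => [|nu _].
  by apply/eqP; apply/negPn/negP => /hall_littlewood_degree/eqP.
rewrite /monomial_sym; case: (boolP (perm_eq _ _)); rewrite ?mulr0 // => /perm_sumn e.
by case: nz; rewrite [sumn _]e intpart_sumn.
Qed.

Lemma hl_coefP la m : hall_littlewood la m =
  \sum_(mu : intpart n | dominated mu la) hl_coef la mu * monomial_sym _ mu m.
Proof.
have ex : exists c : intpart n -> {poly int}, forall m : {mset nat},
    hall_littlewood la m = \sum_(mu : intpart n | dominated mu la) c mu * monomial_sym _ mu m.
  by exists (fun mu => hall_littlewood la (mset_of_part mu)) => m'; exact: hall_littlewood_expand.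
exact: (classical_sets.xgetPex (fun=> 0) ex).
Qed.

(** Evaluating the expansion at the monomial of [mu] isolates one term, so the chosen coefficients
    are determined on the partitions dominated by [la]. *)
Lemma hl_coefE la mu : dominated mu la -> hl_coef la mu = hall_littlewood la (mset_of_part mu).
Proof.
move=> dmu; rewrite hl_coefP (bigD1 mu) //= big1 ?addr0 => [|nu /andP[_ neq]].
  by rewrite /monomial_sym [perm_eq _ _]mset_type_of_part mulr1.
rewrite /monomial_sym; case: (boolP (perm_eq _ _)); rewrite ?mulr0 // => pnu.
case/eqP: neq; apply: intpart_perm_inj; rewrite perm_sym in pnu.
exact: perm_trans pnu (mset_type_of_part mu).
Qed.

(** Evaluation at 1 is a ring morphism sending [t] to 1, so the specialized quotient yields the
    coefficient. *)
Lemma hl_coef_at1 la mu : dominated mu la -> (hl_coef la mu).[1] = (mu == la)%:R.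
Proof.
move=> dmu; rewrite hl_coefE //; pose N := maxn (size la) (size mu).
have leN : (size la <= N)%N by rewrite leq_maxl.
have leNmu : (size mu <= N)%N by rewrite leq_maxr.
have mN := mset_of_part0 leNmu; rewrite (hall_littlewoodE leN mN).
have e1 : horner_eval (1 : int) 'X = 1 by rewrite /horner_eval hornerX.
have := hl_quotient_spec1 [multinom mset_of_part mu i | i < N] e1 (size_zero_pad leN) (hl_polyP
  leN).
move=> e; rewrite -[LHS]/(horner_eval 1 _) [LHS]e; congr ((nat_of_bool _)%:R).
rewrite (eq_ord_image (g := fun i : 'I_N => mset_of_part mu i)) => [|i]; last by rewrite mnmE.
rewrite mset_type_pad //; apply/idP/eqP => [pla|<-]; last exact: mset_type_of_part.
apply: intpart_perm_inj; have := mset_type_of_part mu; rewrite perm_sym => pmu.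
exact: perm_trans pmu pla.
Qed.
End Triangularity.

(** * Set partitions as kernels *)

Section YoungSubgroup.
Variables (T K : finType) (f : T -> K).
Local Open Scope group_scope.

(** Permutations preserving the fibres of [f] and moving only points over [S]; letting [S] vary
    permits an induction on the fibres. *)
Definition fiber_perms (S : {pred K}) : {set {perm T}} :=
  [set s : {perm T} | [forall x, (f (s x) == f x) && ((f x \in S) || (s x == x))]].

Lemma fiber_permsP (S : {pred K}) (s : {perm T}) :
  reflect (forall x, f (s x) = f x /\ (f x \notin S -> s x = x)) (s \in fiber_perms S).
Proof.
rewrite inE; apply: (iffP forallP) => H x.
  by have /andP[/eqP -> /orP[->//|/eqP ->]] := H x.
by have [-> h] := H x; rewrite eqxx /=; case: (boolP (f x \in S)) => //= /h ->.
Qed.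

Lemma fiber_perms_group_set S : group_set (fiber_perms S).
Proof.
apply/group_setP; split=> [|s t /fiber_permsP Gs /fiber_permsP Gt].
  by apply/fiber_permsP => x; rewrite perm1.
apply/fiber_permsP => x; rewrite permM; have [fs es] := Gs x; have [ft et] := Gt (s x).
split=> [|fx]; first by rewrite ft.
by rewrite et ?es // fs.
Qed.
Canonical fiber_perms_group S := Group (fiber_perms_group_set S).

(** Adding a value [c] to [S] multiplies the group by the symmetric group of the fibre over [c],
    which meets the former group trivially. *)
Lemma card_fiber_perms_seq (S : seq K) : uniq S ->
  #|fiber_perms (mem S)| = (\prod_(c <- S) (#|[set x | f x == c]|)`!)%N.
Proof.
elim: S => [|c S IHS] /=.
  move=> _; rewrite big_nil; apply/eqP/cards1P; exists 1; apply/setP => s; rewrite inE.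
  apply/fiber_permsP/eqP => [H|-> x]; last by rewrite perm1.
  by apply/permP => x; rewrite perm1; have [_ ->] := H x.
case/andP=> cS /IHS {}IHS; rewrite big_cons -IHS; set A := [set x | f x == c].
have AP x : (x \in A) = (f x == c) by rewrite inE.
rewrite -card_Sym -TI_cardMg /=; last first.
  apply/trivgP/subsetP => s /setIP[]; rewrite inE => sA /fiber_permsP Gs.
  apply/set1P/permP => x; rewrite perm1.
  have [xA|xA] := boolP (x \in A); last exact: out_perm sA xA.
  by have [_ ->] := Gs x; rewrite //; move: xA; rewrite AP => /eqP ->.
congr #|pred_of_set _|; apply/setP => s; apply/fiber_permsP/mulsgP.
  move=> Gs.
  (* The factor in the symmetric group of [A] is [s] on [A] and the identity elsewhere, injective
     because [s] preserves [A]. *)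
  have inj_a : injective (fun x => if x \in A then s x else x).
    move=> x y; have [fx _] := Gs x; have [fy _] := Gs y.
    rewrite !AP; case: (eqVneq (f x) c) => ex; case: (eqVneq (f y) c) => ey //.
    - exact: perm_inj.
    - by move=> e; rewrite -e fx ex eqxx in ey.
    - by move=> e; rewrite e fy ey eqxx in ex.
  pose a := perm inj_a; have aE x : a x = if x \in A then s x else x by rewrite permE.
  exists a (a^-1 * s); rewrite ?mulKVg ?mulVKg //.
    rewrite inE; apply/subsetP => x; rewrite inE aE; by case: ifP => //; rewrite eqxx.
  apply/fiber_permsP => x; rewrite permM; set y := a^-1 x.
  have -> : x = a y by rewrite permKV.
  rewrite aE AP; have [fy ey] := Gs y; case: (eqVneq (f y) c) => e //.
  by split=> // fS; apply: ey; rewrite inE negb_or e.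
move=> [a b]; rewrite inE => aA /fiber_permsP Gb -> x; rewrite permM.
have [fb eb] := Gb (a x).
have [xA|xA] := boolP (x \in A).
  have := perm_closed x aA; rewrite xA AP => /eqP fax; rewrite fb fax.
  by move: xA; rewrite AP => /eqP ->; rewrite inE eqxx.
move: fb eb; rewrite (out_perm aA xA) => -> eb; split=> //.
by rewrite inE negb_or => /andP[_ /eb].
Qed.

Lemma card_fiber_perms :
  #|[set s : {perm T} | [forall x, f (s x) == f x]]| = (\prod_(c : K) (#|[set x | f x == c]|)`!)%N.
Proof.
rewrite -big_enum -card_fiber_perms_seq ?enum_uniq //; apply: eq_card => s; rewrite !inE.
by apply: eq_forallb => x; rewrite mem_enum andbT.
Qed.
End YoungSubgroup.

Lemma size_ord_map n (T : Type) (F : 'I_n -> T) : size [seq F i | i <- enum 'I_n] = n.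
Proof. by rewrite size_map size_enum_ord. Qed.

Section KernelPartition.
Variables (n : nat) (T : eqType).
Implicit Types f : 'I_n -> T.

Definition ker_part f : {set {set 'I_n}} := [set [set b | f b == f a] | a : 'I_n].

Lemma pblock_ker_part f a : pblock (ker_part f) a = [set b | f b == f a].
Proof.
apply: def_pblock; rewrite ?imset_f ?inE ?eqxx //.
apply/trivIsetP => _ _ /imsetP[x _ ->] /imsetP[y _ ->] neq.
rewrite -setI_eq0; apply: contraNT neq => /set0Pn[z]; rewrite !inE => /andP[/eqP <- /eqP <-].
exact: eqxx.
Qed.

Lemma eq_pblock_ker_part f a b :
  (pblock (ker_part f) a == pblock (ker_part f) b) = (f a == f b).
Proof.
rewrite !pblock_ker_part; apply/eqP/eqP => [/setP/(_ a)|e]; last by apply/setP => c; rewrite !inE e.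
by rewrite !inE eqxx => /esym/eqP.
Qed.

Lemma perm_act_ker_part (d : 'S_n) f : perm_act d (ker_part f) = ker_part (f \o d^-1%g).
Proof.
have im a : d @: [set b | f b == f a] = [set b | f (d^-1%g b) == f a].
  apply/setP => x; rewrite inE -{1}[x](permKV d) (mem_imset _ _ perm_inj) inE; by [].
rewrite /perm_act /ker_part -imset_comp; apply/setP => B; apply/imsetP/imsetP => -[a _ ->].
  by exists (d a); rewrite //= im permK.
by exists (d^-1%g a); rewrite //= im.
Qed.
End KernelPartition.

Definition ker_word n (T : eqType) (f : 'I_n -> T) (w : seq nat) : bool :=
  (size w == n) &&
  [forall a : 'I_n, forall b : 'I_n, (nth 0 w a == nth 0 w b)%N == (f a == f b)].

Lemma nc_monomial_ker_part (R : pzSemiRingType) n (T : eqType) (f : 'I_n -> T) w :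
  nc_monomial R (ker_part f) w = (ker_word f w)%:R.
Proof.
rewrite /nc_monomial /ker_word; congr ((nat_of_bool (_ && _))%:R).
by apply: eq_forallb => a; apply: eq_forallb => b; rewrite eq_pblock_ker_part.
Qed.

Lemma ker_wordP n (T : eqType) (f : 'I_n -> T) w : size w = n ->
  reflect (forall a b : 'I_n, (nth 0%N w a == nth 0%N w b) = (f a == f b)) (ker_word f w).
Proof.
move=> sw; rewrite /ker_word sw eqxx /=.
by apply: (iffP forallP) => H a; [move=> b; have /forallP/(_ b)/eqP := H a|apply/forallP => b;
  rewrite H].
Qed.

Lemma eq_ker_part n (T U : eqType) (f : 'I_n -> T) (g : 'I_n -> U) :
  (forall a b, (f a == f b) = (g a == g b)) <-> ker_part f = ker_part g.
Proof.
split=> [e|e a b]; last by rewrite -eq_pblock_ker_part e eq_pblock_ker_part.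
by apply: eq_imset => a; apply/setP => b; rewrite !inE e.
Qed.

(** Letter [a] of the word tested on the left is letter [g a] of [w], so [f] there corresponds to
    [f] composed with the inverse of [g]. *)
Lemma nc_act_ker_part (R : pzSemiRingType) n (T : eqType) (f : 'I_n -> T) (g : 'S_n) w :
  nc_act g (nc_monomial R (ker_part f)) w = nc_monomial R (perm_act g (ker_part f)) w.
Proof.
rewrite /nc_act perm_act_ker_part !nc_monomial_ker_part; congr ((nat_of_bool _)%:R).
have [sw|sw] := eqVneq (size w) n; last by rewrite /ker_word size_word_act (negPf sw).
apply/ker_wordP/ker_wordP => //; rewrite ?size_word_act // => H a b.
  by rewrite /= -H !nth_word_act // invgK !permKV.
by rewrite !nth_word_act // invgK H /= !permK.
Qed.

(** * Counting words with given kernel and content, and the stabilizer *)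

Section WordCount.
Variables (n : nat) (mu : intpart n) (f : 'I_n -> 'I_(size mu)).
Hypothesis card_f : forall i, #|[set a | f a == i]| = nth 0%N mu i.
Implicit Type m : {mset nat}.

(** The parts of [mu] are nonzero, so [f] is onto and a position can be chosen in every block. *)
Lemma fiber_section : exists h : 'I_(size mu) -> 'I_n, cancel h f.
Proof.
have ex i : exists a, f a == i.
  have : (0 < #|[set a | f a == i]|)%N.
    rewrite card_f lt0n; apply: contraTneq (mem_nth 0%N (ltn_ord i)) => ->.
    by case/and3P: (intpartP mu).
  by case/card_gt0P => a; rewrite inE; exists a.
by exists (fun i => xchoose (ex i)) => i; apply/eqP; exact: (xchooseP (ex i)).
Qed.

Lemma count_mem_word (h : 'I_(size mu) -> nat) (i : 'I_(size mu)) : injective h ->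
  count_mem (h i) [seq h (f a) | a <- enum 'I_n] = nth 0%N mu i.
Proof.
move=> inj_h; rewrite count_map -card_f cardE -size_filter; apply: perm_size; apply: uniq_perm.
- by rewrite filter_uniq ?enum_uniq.
- exact: enum_uniq.
move=> a; by rewrite mem_filter !mem_enum !inE /= (inj_eq inj_h) andbT.
Qed.

Lemma perm_eq_mset (w : seq nat) m : (forall x, count_mem x w = m x) -> perm_eq w m.
Proof. by move=> e; apply/allP => x _ /=; rewrite e count_mem_mset. Qed.

Lemma ker_word_factor w : ker_word f w ->
  exists2 h : 'I_(size mu) -> nat, injective h & w = [seq h (f a) | a <- enum 'I_n].
Proof.
have [sec secK] := fiber_section; move=> kw; have sw : size w = n by case/andP: kw => /eqP.
move/(ker_wordP _ sw) in kw; exists (fun i => nth 0%N w (sec i)).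
  by move=> i j /eqP; rewrite kw !secK => /eqP.
rewrite -[LHS](map_nth_enum sw); apply: eq_map => a; apply/eqP.
by rewrite kw secK.
Qed.

Lemma word_finsupp m (h : 'I_(size mu) -> nat) : injective h ->
  perm_eq [seq h (f a) | a <- enum 'I_n] m ->
  (forall i, m (h i) = nth 0%N mu i) /\ perm_eq (finsupp m) [seq h i | i <- enum 'I_(size mu)].
Proof.
move=> inj_h pm; have mE x : m x = count_mem x [seq h (f a) | a <- enum 'I_n].
  by rewrite -count_mem_mset (seq.permP pm).
have mh i : m (h i) = nth 0%N mu i by rewrite mE count_mem_word.
split=> //; apply: uniq_perm; rewrite ?fset_uniq ?(map_inj_uniq inj_h) ?enum_uniq // => x.
rewrite mem_finsupp mE -lt0n -has_count has_pred1; apply/mapP/mapP => -[a _ ->].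
  by exists (f a); rewrite ?mem_enum.
have [sec secK] := fiber_section.
by exists (sec a); rewrite ?secK ?mem_enum.
Qed.

Lemma ker_word_type w m : ker_word f w -> perm_eq w m -> perm_eq (mset_type m) mu.
Proof.
case/ker_word_factor => h inj_h -> /(word_finsupp inj_h)[mh pm].
rewrite /mset_type (perm_trans (perm_map _ pm)) // -map_comp.
by rewrite (eq_map (g := fun i : 'I_(size mu) => nth 0%N mu i) mh) map_nth_enum.
Qed.

Lemma card_parts_perm :
  #|[set s : 'S_(size mu) | [forall i, nth 0%N mu (s i) == nth 0%N mu i]]| = mult_fact mu.
Proof.
have lemu i : (nth 0 mu i < n.+1)%N.
  rewrite ltnS; have [lti|lei] := ltnP i (size mu); last by rewrite nth_default.
  rewrite -[leqRHS](intpart_sumn mu) sumnE (big_nth 0%N) big_mkord (bigD1 (Ordinal lti)) //=.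
  exact: leq_addr.
pose F (i : 'I_(size mu)) : 'I_n.+1 := inord (nth 0%N mu i).
have FE i : F i = nth 0%N mu i :> nat by rewrite inordK.
transitivity (\prod_(c : 'I_n.+1) (#|[set i | F i == c]|)`!)%N.
  rewrite -card_fiber_perms; apply: eq_card => s; rewrite !inE.
  by apply: eq_forallb => i; rewrite -val_eqE /= !FE.
have cE (c : 'I_n.+1) : #|[set i | F i == c]| = count_mem (c : nat) mu.
  rewrite -sum1_card -sum1_count [RHS](big_nth 0%N) big_mkord.
  by apply: eq_bigl => i; rewrite inE -val_eqE /= FE.
rewrite (eq_bigr _ (fun c _ => congr1 factorial (cE c))) /mult_fact.
(* No part is 0, so the factor for [c = 0] is 0! = 1 and the product may start at 1. *)
rewrite -(big_mkord xpredT (fun c => (count_mem c mu)`!)) big_nat_recl //=.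
rewrite (count_memPn (intpart_notin0 mu)) mul1n big_add1 /=.
by [].
Qed.

Lemma mset_type_enum m : perm_eq (mset_type m) mu ->
  exists2 h : 'I_(size mu) -> nat, injective h &
    (forall i, m (h i) = nth 0%N mu i) /\ perm_eq (finsupp m) [seq h i | i <- enum 'I_(size mu)].
Proof.
rewrite perm_sym => /(perm_iotaP 0%N)[Is pIs emu].
have sIs : size Is = size mu by rewrite emu size_map.
have smt : size (mset_type m) = size mu by rewrite -sIs (perm_size pIs) size_iota.
have sf : size (finsupp m) = size mu by rewrite -smt size_map.
have ltIs j : j \in Is -> (j < size (finsupp m))%N.
  by rewrite (perm_mem pIs) mem_iota size_map.
pose h (i : 'I_(size mu)) := nth 0%N (finsupp m) (nth 0%N Is i).
have uIs : uniq Is by rewrite (perm_uniq pIs) iota_uniq.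
have inIs (i : 'I_(size mu)) : nth 0%N Is i \in Is by rewrite mem_nth // sIs.
have inj_h : injective h.
  move=> i j /eqP; rewrite /h nth_uniq ?fset_uniq ?ltIs //.
  by rewrite nth_uniq ?sIs // => /eqP/val_inj.
exists h => //; split.
  move=> i; have /= -> := congr1 (fun s => nth 0%N s i) emu.
  rewrite (nth_map 0%N) ?sIs // /mset_type (nth_map 0%N) //.
  exact: ltIs.
have uh : uniq [seq h i | i <- enum 'I_(size mu)] by rewrite (map_inj_uniq inj_h) enum_uniq.
have sub : {subset [seq h i | i <- enum 'I_(size mu)] <= finsupp m}.
  by move=> _ /mapP[i _ ->]; rewrite mem_nth // ltIs.
have [|_ eqh] := uniq_min_size uh sub; first by rewrite size_map size_enum_ord sf.
by rewrite perm_sym; apply: uniq_perm; rewrite ?fset_uniq.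
Qed.

(** A word with kernel [f] is an injective labelling of the blocks by letters. One labelling [h]
    compatible with [m] being fixed, the others are [h] composed with a permutation of the parts
    preserving their sizes. *)
Lemma count_ker_word m :
  count (ker_word f) (permutations (enum_mset m)) = (mult_fact mu * perm_eq (mset_type m) mu)%N.
Proof.
case: (boolP (perm_eq (mset_type m) mu)) => [pm|npm]; last first.
  rewrite muln0; apply/eqP; rewrite -leqn0 leqNgt -has_count; apply: contra npm => /hasP[w].
  by rewrite mem_permutations => pw kw; exact: ker_word_type kw pw.
have [h inj_h [mh ph]] := mset_type_enum pm.
rewrite muln1 -card_parts_perm cardE -(size_map (fun s : 'S_(size mu) => [seq h (s (f a)) | a
  <- enum 'I_n])).
rewrite -size_filter; have [sec secK] := fiber_section.
have inj_hs (s : 'S_(size mu)) : injective (fun i => h (s i)).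
  by move=> i j /inj_h /perm_inj.
apply: perm_size; apply: uniq_perm;
  rewrite ?filter_uniq ?permutations_uniq ?map_inj_uniq ?enum_uniq //.
  move=> s t e; apply/permP => i; apply: inj_h.
  have := congr1 (fun w => nth 0%N w (sec i)) e.
  by rewrite !nth_enum_map secK.
move=> w; rewrite mem_filter mem_permutations; apply/andP/mapP.
  move=> [/ker_word_factor[g inj_g ->] /(word_finsupp inj_g)[mg pg]].
  have exs i : exists j, h j == g i.
    have : g i \in [seq g i | i <- enum 'I_(size mu)] by rewrite map_f ?mem_enum.
    by rewrite -(perm_mem pg) (perm_mem ph) => /mapP[j _ ->]; exists j.
  (* [g] and [h] label by the same support, so each label of [g] is a label of [h]; this defines the
     permutation relating them. *)
  pose s0 i := xchoose (exs i); have s0E i : h (s0 i) = g i by exact/eqP/(xchooseP (exs i)).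
  have inj_s0 : injective s0 by move=> i j e; apply: inj_g; rewrite -!s0E e.
  exists (perm inj_s0); last by apply: eq_map => a; rewrite permE s0E.
  by rewrite mem_enum inE; apply/forallP => i; rewrite permE -mh s0E mg.
move=> [s]; rewrite mem_enum inE => /forallP mus ->; split.
  apply/ker_wordP; rewrite ?size_ord_map // => a b.
  by rewrite !nth_enum_map (inj_eq (inj_hs s)).
apply: perm_eq_mset => x; have [xs|xs] := boolP (x \in finsupp m).
  have := xs; rewrite (perm_mem ph) => /mapP[j _ ->].
  rewrite -[j](permKV s) (count_mem_word _ (inj_hs s)) mh.
  by rewrite (eqP (mus _)).
have -> : m x = 0%N by apply/eqP; rewrite mem_finsupp negbK in xs.
apply/count_memPn; apply: contra xs => /mapP[a _ ->].
by rewrite (perm_mem ph) map_f ?mem_enum.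
Qed.

Lemma rho_ker_part (R : pzSemiRingType) m :
  rho (nc_monomial R (ker_part f)) m = (mult_fact mu)%:R * monomial_sym R mu m.
Proof.
rewrite /rho; under eq_bigr do rewrite nc_monomial_ker_part.
by rewrite -natr_sum /monomial_sym -natrM -count_ker_word -sum1_count [in RHS]big_mkcond.
Qed.

(** [g] fixes [pi] exactly when the word of [f] composed with [g] has kernel [f]. There are
    [mult_fact mu] such words, and each comes from a coset of the group preserving the fibres of
    [f], of order [part_fact mu]. *)
Lemma card_stab (pi : setpart n) : blocks pi = ker_part f ->
  #|stab pi| = (part_fact mu * mult_fact mu)%N.
Proof.
move=> pif; pose w0 := [seq f a : nat | a <- enum 'I_n]; pose m0 := seq_mset w0.
pose word (g : 'S_n) := [seq f (g a) : nat | a <- enum 'I_n].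
have stabE g : (g \in stab pi) = ker_word f (word g).
  rewrite inE pif perm_act_ker_part; apply/eqP/ker_wordP.
  - exact: size_ord_map.
  - move=> /eq_ker_part e a b; rewrite !nth_enum_map.
    by have := e (g a) (g b); rewrite (inj_eq val_inj) /= !permK => ->.
  move=> e; apply/eq_ker_part => a b /=.
  by have := e (g^-1%g a) (g^-1%g b); rewrite !nth_enum_map !permKV (inj_eq val_inj) => ->.
have pw0 : perm_eq w0 m0 by rewrite perm_sym perm_eq_seq_mset.
have kw0 : ker_word f w0.
  by apply/ker_wordP; rewrite ?size_ord_map // => a b; rewrite !nth_enum_map.
have tm0 := ker_word_type kw0 pw0.
have wordP g : perm_eq (word g) m0.
  apply: perm_trans pw0; rewrite /word /w0 (map_comp (fun a => f a : nat) g); apply: perm_map.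
  apply: uniq_perm; rewrite ?(map_inj_uniq perm_inj) ?enum_uniq // => a.
  by rewrite mem_enum -[a](permKV g) map_f ?mem_enum.
pose L := [seq w <- permutations m0 | ker_word f w].
have uL : uniq L by rewrite filter_uniq ?permutations_uniq.
have -> : #|stab pi| = (\sum_(v <- L) #|[set g | word g == v]|)%N.
  under [RHS]eq_bigr do rewrite -sum1_card.
  rewrite -sum1_card (exchange_big_dep predT) //= [LHS]big_mkcond; apply: eq_bigr => g _.
  under eq_bigl do rewrite inE.
  rewrite sum1_count stabE.
  rewrite (eq_count (a2 := pred1 (word g))) => [|v]; last by rewrite /= eq_sym.
  by rewrite count_uniq_mem // mem_filter mem_permutations wordP andbT; case: ifP.
have cY : #|[set s : 'S_n | [forall x, f (s x) == f x]]| = part_fact mu.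
  rewrite card_fiber_perms; under eq_bigr do rewrite card_f.
  by rewrite /part_fact (big_nth 0%N) big_mkord.
rewrite big_seq (eq_bigr (fun=> part_fact mu)) => [|v].
  rewrite -big_seq big_const_seq count_predT iter_addn_0 size_filter count_ker_word tm0 muln1.
  by [].
rewrite mem_filter mem_permutations => /andP[_ pv].
have sv : perm_eq v w0 by rewrite (perm_trans pv) // perm_sym.
have /(@tuple_permP _ _ _ [tuple (f a : nat) | a < n])[p ev] := sv.
have {}ev : v = word p.
  by rewrite ev; apply: eq_map => a; rewrite tnth_mktuple.
(* The permutations giving the word of [p] form the left coset of [p]. *)
rewrite -cY -[RHS](card_lcoset _ p); apply: eq_card => g; rewrite mem_lcoset !inE.
apply/eqP/forallP => [e x|H].
  have := congr1 (fun w => nth 0%N w (p^-1%g x)) e; rewrite ev !nth_enum_map permM permKV.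
  by move/val_inj => ->.
rewrite ev; apply: eq_map => a; have := H (p a); rewrite permM permK => /eqP ->.
by [].
Qed.

End WordCount.

(** * Interval set partitions as kernels *)

Section IntervalBlocks.
Variables (n : nat) (mu : intpart n).

Definition interval_index (a : 'I_n) : 'I_(size mu) :=
  Ordinal (reshape_indexP (leq_trans (ltn_ord a) (eq_leq (esym (intpart_sumn mu))))).

Lemma sumn_takeS (s : seq nat) i : (i < size s)%N ->
  sumn (take i.+1 s) = (sumn (take i s) + nth 0 s i)%N.
Proof. by move=> lti; rewrite (take_nth 0%N) // sumn_rcons. Qed.

Lemma sumn_take_parts i : (sumn (take i mu) <= n)%N.
Proof.
rewrite -[leqRHS](intpart_sumn mu) -[X in (_ <= sumn X)%N](cat_take_drop i mu) sumn_cat.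
exact: leq_addr.
Qed.

Lemma interval_indexE (a : 'I_n) (i : 'I_(size mu)) :
  (interval_index a == i) = (sumn (take i mu) <= a < sumn (take i.+1 mu))%N.
Proof.
have lta : (a < sumn mu)%N by rewrite intpart_sumn.
rewrite -val_eqE /=; apply/eqP/andP => [<-|[]].
  rewrite sumn_takeS ?reshape_indexP //.
  have := reshape_offsetP lta; have := reshape_indexK mu a; rewrite /flatten_index.
  move: (reshape_index mu a) (reshape_offset mu a) => r c <- ltc.
  by rewrite leq_addr ltn_add2l.
rewrite sumn_takeS // => le lt.
rewrite -(subnKC le); apply: (@flatten_indexKl mu i (a - sumn (take i mu))).
by rewrite ltn_subLR.
Qed.

Lemma card_interval_index (i : 'I_(size mu)) :
  #|[set a | interval_index a == i]| = nth 0%N mu i.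
Proof.
rewrite -sum1_card; under eq_bigl do rewrite inE interval_indexE andbC.
set lo := sumn (take i mu); set hi := sumn (take i.+1 mu).
rewrite -(big_mkord (fun a => (a < hi) && (lo <= a))%N (fun=> 1%N)).
rewrite -(big_nat_widenl lo 0 n (fun a => a < hi)%N) //.
rewrite -(big_nat_widen lo hi n xpredT) ?sumn_take_parts // sum_nat_const_nat muln1.
by rewrite /hi sumn_takeS // addKn.
Qed.

(** Every interval contains a point, so indexing the blocks by parts or by points gives the same
    set. *)
Lemma interval_blocksE : interval_blocks mu = ker_part interval_index.
Proof.
have [sec secK] := fiber_section card_interval_index.
have blockE (i : 'I_(size mu)) :
    [set a : 'I_n | (sumn (take i mu) <= a < sumn (take i.+1 mu))%N] =
    [set b | interval_index b == i].
  by apply/setP => a; rewrite !inE interval_indexE.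
apply/setP => B; apply/imsetP/imsetP => -[i _ ->].
  by exists (sec i); rewrite // secK blockE.
by exists (interval_index i); rewrite // blockE.
Qed.

Lemma perm_act_interval_blocks (d : 'S_n) :
  perm_act d (interval_blocks mu) = ker_part (interval_index \o d^-1%g).
Proof. by rewrite interval_blocksE perm_act_ker_part. Qed.

Lemma card_perm_interval_index (d : 'S_n) i :
  #|[set a | (interval_index \o d^-1%g) a == i]| = nth 0%N mu i.
Proof.
rewrite -card_interval_index -[RHS](card_imset _ (@perm_inj _ d)); apply: eq_card => a.
by rewrite -{2}[a](permKV d) mem_imset ?inE //; exact: perm_inj.
Qed.
End IntervalBlocks.

Lemma perm_actM n (g h : 'S_n) (P : {set {set 'I_n}}) :
  perm_act (h * g)%g P = perm_act g (perm_act h P).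
Proof.
rewrite /perm_act -imset_comp; apply: eq_imset => B /=; rewrite -imset_comp.
by apply: eq_imset => a; rewrite permM.
Qed.

(** * The permutation listing the blocks *)

Section Delta.
Variables (n : nat) (pi : setpart n).
Let la := block_type pi.
Let bs := sort (@block_le n) (enum (blocks pi)).

Lemma block_le_total : total (@block_le n).
Proof. by move=> B C; rewrite /block_le [#|C| == _]eq_sym; case: ltngtP => //= _;
  exact: leq_total. Qed.

(** [block_le] refines the order by decreasing size, so both sides are weakly decreasing
    rearrangements of the same sizes. *)
Lemma parts_block_type : la = [seq #|(B : {set 'I_n})| | B <- bs] :> seq nat.
Proof.
apply: (@sorted_eq _ geq) => //=.
- by move=> x y z /= yx xz; exact: leq_trans xz yx.
- by move=> x y /= /andP[xy yx]; apply/eqP; rewrite eqn_leq xy yx.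
- exact: (intpart_sorted la).
- apply: homo_sorted (sort_sorted block_le_total _) => B C /orP[/ltnW//|/andP[/eqP -> _]].
  exact: leqnn.
rewrite perm_sort perm_sym; apply: perm_map.
by rewrite perm_sort.
Qed.

(** Cutting the one-line notation into pieces of lengths [la] recovers the sorted blocks, and
    [delta pi] sends the [i]-th interval onto the [i]-th piece. *)
Lemma delta_interval_blocks : perm_act (delta pi) (interval_blocks la) = pi.
Proof.
have sbs : size bs = size la by rewrite parts_block_type size_map.
pose ss := [seq enum (B : {set 'I_n}) | B <- bs].
have shss : shape ss = la.
  by rewrite parts_block_type /shape -map_comp; apply: eq_map => B /=; rewrite -cardE.
have reshapeE : reshape la (one_line pi) = ss by rewrite -shss; exact: flattenK.
have sizeL : size (one_line pi) = n := one_line_size pi.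
have img (i : 'I_(size la)) :
    delta pi @: [set a : 'I_n | (sumn (take i la) <= a < sumn (take i.+1 la))%N] = nth set0 bs i.
  have nthss : enum (nth set0 bs i) = take (nth 0%N la i) (drop (sumn (take i la)) (one_line pi)).
    rewrite -nth_reshape -[LHS](nth_map set0 [::] (fun B : {set 'I_n} => enum B)) ?sbs //.
    by rewrite reshapeE.
  have sumS := sumn_takeS (ltn_ord i).
  have lehi : (sumn (take i la) + nth 0 la i <= n)%N by rewrite -sumS sumn_take_parts.
  have szt : size (take (nth 0%N la i) (drop (sumn (take i la)) (one_line pi))) = nth 0%N la i.
    by rewrite size_takel // size_drop sizeL leq_subRL // (leq_trans (leq_addr _ _) lehi).
  apply/setP => x; rewrite -[RHS]mem_enum nthss; apply/imsetP/(nthP x) => [[a]|[c]].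
    rewrite inE sumS => /andP[le lt] ex.
    have ltc : (a - sumn (take i la) < nth 0%N la i)%N by rewrite ltn_subLR.
    exists (a - sumn (take i la))%N; rewrite ?szt // nth_take // nth_drop subnKC //.
    by rewrite [RHS]ex permE /one_line_fun (tnth_nth x).
  rewrite szt => ltc ex; have lta : (sumn (take i la) + c < n)%N.
    by rewrite (leq_trans _ lehi) // ltn_add2l.
  exists (Ordinal lta); first by rewrite inE /= leq_addr sumS ltn_add2l.
  by rewrite -[LHS]ex permE /one_line_fun (tnth_nth x) /= nth_take // nth_drop.
rewrite /perm_act /interval_blocks -imset_comp; apply/setP => B.
have -> : (B \in blocks pi) = (B \in bs) by rewrite mem_sort mem_enum.
apply/imsetP/(nthP set0) => [[i _ ->]|[i]].
  by exists i; rewrite ?sbs //= img.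
by rewrite sbs => lti <-; exists (Ordinal lti); rewrite //= (img (Ordinal lti)).
Qed.
End Delta.

(** * Projection and specialization of the noncommutative functions *)

Lemma horner_nc_monomial (R : comNzRingType) n (P : {set {set 'I_n}}) w (x : R) :
  (nc_monomial {poly R} P w).[x] = nc_monomial R P w.
Proof. by rewrite /nc_monomial -polyC_natr hornerC. Qed.

Lemma dominated_refl n (la : intpart n) : dominated la la.
Proof. exact/forallP. Qed.

(** Cancels the division by [mu^!] against the factor [mu^!] produced by [rho]; [l] will be the
    order of the stabilizer. *)
Lemma scale_nat_cancel (k l : nat) (c x : {poly rat}) : k%:R != 0 :> rat ->
  k%:R^-1 *: c * (k%:R * x *+ l) = l%:R * (c * x).
Proof.
move=> k0; rewrite [k%:R * x]mulr_natl -[x *+ k]scaler_nat scalerMnr -scalerAl -scalerAr scalerA.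
by rewrite mulVf // scale1r mulrnAr mulr_natl.
Qed.

Theorem proposition3p1 (n : nat) (pi : setpart n) :
  let la := block_type pi in
  (nc_hall_littlewood_at pi 1 =1
     fun w => (part_fact la)%:R * nc_monomial rat pi w)
  /\
  (rho (nc_hall_littlewood pi) =1
     fun m => (part_fact la * mult_fact la)%N%:R
              * map_poly intr (hall_littlewood la m))
  /\
  (rho (nc_schur pi) =1
     fun m => (part_fact la * mult_fact la)%N%:R * (schur la m)%:~R).
Proof.
move=> la; pose idx := interval_index la \o (delta pi)^-1%g.
have pi_ker : blocks pi = ker_part idx.
  by rewrite -perm_act_interval_blocks delta_interval_blocks.
have cardG : #|stab pi| = (part_fact la * mult_fact la)%N.
  apply: card_stab pi_ker; exact: card_perm_interval_index.
have mult_neq0 (mu : intpart n) : (mult_fact mu)%:R != 0 :> rat.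
  by rewrite Num.Theory.pnatr_eq0 -lt0n prodn_gt0 // => i; exact: fact_gt0.
have actE (R : pzSemiRingType) (mu : intpart n) g w :
    nc_act g (nc_monomial R (perm_act (delta pi) (interval_blocks mu))) w =
    nc_monomial R (perm_act (delta pi * g)%g (interval_blocks mu)) w.
  by rewrite perm_act_interval_blocks nc_act_ker_part -perm_act_interval_blocks -perm_actM.
have rhoE : rho (nc_hall_littlewood pi) =1
    fun m => (part_fact la * mult_fact la)%N%:R * map_poly intr (hall_littlewood la m).
  move=> m; rewrite hl_coefP rmorph_sum mulr_sumr /rho /nc_hall_littlewood exchange_big.
  apply: eq_bigr => mu _; rewrite -mulr_sumr exchange_big.
  (* The projection depends only on the block sizes, so all [g] contribute equally. *)
  rewrite (eq_bigr (fun=> (mult_fact mu)%:R * monomial_sym {poly rat} mu m)) => [|g _]; last first.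
    under eq_bigr do rewrite actE perm_act_interval_blocks.
    exact: (rho_ker_part (@card_perm_interval_index n mu (delta pi * g)%g)).
  rewrite sumr_const cardG [LHS]scale_nat_cancel //; congr (_ * _).
  by rewrite [RHS]rmorphM; congr (_ * _); rewrite /monomial_sym /= rmorph_nat.
split; last split=> // m.
  move=> w; rewrite /nc_hall_littlewood_at /nc_hall_littlewood horner_sum.
  have at1 (mu : intpart n) : dominated mu la ->
      (map_poly intr (hl_coef la mu) : {poly rat}).[1] = (mu == la)%:R.
    by move=> dmu; rewrite -(rmorph1 (intr : int -> rat)) horner_map hl_coef_at1 // rmorph_nat.
  (* At [t = 1] only [mu = la] survives. *)
  rewrite (bigD1 la) ?dominated_refl // [X in _ + X = _]big1 ?addr0 => [|mu /andP[dmu neq]];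
    last first.
    by rewrite hornerM hornerZ at1 // (negPf neq) mulr0 mul0r.
  rewrite hornerM hornerZ at1 ?dominated_refl // eqxx mulr1 horner_sum.
  (* Every [g] in the stabilizer gives the monomial function of [pi] itself; the order of the
     stabilizer divided by [mult_fact la] leaves [part_fact la]. *)
  rewrite (eq_bigr (fun=> nc_monomial rat pi w)) => [|g].
    rewrite sumr_const cardG -[_ *+ (_ * _)]mulr_natl natrM mulrA [_ * (_%:R * _)]mulrCA.
    by rewrite mulVf ?mulr1.
  rewrite inE => /eqP gpi; rewrite actE horner_nc_monomial perm_actM delta_interval_blocks.
  by rewrite gpi.
(* [rho] is a finite sum of coefficients, hence commutes with evaluation at [t = 0]. *)
transitivity ((rho (nc_hall_littlewood pi) m).[0]); first by rewrite /rho horner_sum.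
rewrite rhoE hornerM -polyC_natr hornerC; congr (_ * _).
by rewrite -(rmorph0 (intr : int -> rat)) horner_map.
Qed.
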